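(* Let $(M^n,g)\hookrightarrow(\tilde M^{n+k},\tilde g)$ be an embedded Riemannian submanifold, $k\ge1$, $v$ a vector field on $M$, $p\in M$, and let $v$ be extended to a neighborhood of $p$ in $\tilde M$ (still denoted $v$). Let $\widetilde{\mathrm{Ric}}\,v=\widetilde{\mathrm{Ric}}(v,\cdot)^\sharp$ and $\mathrm{Ric}\,v=\mathrm{Ric}(v,\cdot)^\sharp$ be the Ricci operators of $\tilde M$ and $M$. Then, evaluating at $p$, $$\widetilde{\mathrm{Ric}}\,v=\mathrm{Ric}\,v-nW_{\mathbf H}v+\sum_{l=1}^k\big(W_{N_l}W_{N_l}v+\delta^{ij}\tilde R(N_l,E_i,v,N_l)E_j\big)+(\widetilde{\mathrm{Ric}}\,v)^\perp.$$ Hence for $M\hookrightarrow\mathbb R^{n+k}$, $$\mathrm{Ric}\,v=nW_{\mathbf H}v-\sum_{l=1}^kW_{N_l}W_{N_l}v.$$ For an embedded hypersurface $M^n\hookrightarrow\tilde M^{n+1}$, evaluating on $M$, $$\widetilde{\mathrm{Ric}}\,v=\mathrm{Ric}\,v-nHsv+s^2v+\delta^{ij}\tilde R(N,E_i,v,N)E_j+(\widetilde{\mathrm{Ric}}\,v)^\perp,$$ and so for a hypersurface $M\hookrightarrow\mathbb R^{n+1}$, $$\mathrm{Ric}\,v=nHsv-s^2v.$$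
   Context: Everything is smooth. $\tilde\nabla,\nabla$ are the Levi-Civita connections of $\tilde M,M$ ($g$ is the induced metric). ${}^T,{}^\perp$ are the orthogonal projections onto $T_pM$ and $(T_pM)^\perp$. $E_1,\dots,E_n$ is a local orthonormal (ON) frame on $M$, $N_1,\dots,N_k$ a local ON frame of the normal bundle ($N=N_1$ if $k=1$), so that together they form an ON frame of $T\tilde M$. Repeated indices $i,j\in\{1,\dots,n\}$ are summed. $\mathrm{II}(X,Y)=(\tilde\nabla_XY)^\perp$; for a normal field $\eta$ the Weingarten map is $g(W_\eta X,Y)=\tilde g(\eta,\mathrm{II}(X,Y))$, i.e. $W_\eta X=-(\tilde\nabla_X\eta)^T$; $\mathbf H=\frac1n\delta^{ij}\mathrm{II}(E_i,E_j)$. For a hypersurface: $s=W_N$ is the shape operator, $H=\frac1n\operatorname{tr}s$ is the mean curvature, so $\mathbf H=HN$. Curvature convention (for both manifolds, tilde for $\tilde M$): $R(X,Y)Z=\nabla_X\nabla_YZ-\nabla_Y\nabla_XZ-\nabla_{[X,Y]}Z$, $R(W,X,Y,Z)=g(R(W,X)Y,Z)$, $\mathrm{Ric}(X,Y)=\sum_aR(F_a,X,Y,F_a)$ over an ON frame $\{F_a\}$ of the manifold in question. *)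

(* Defs.v *)
From HB Require Import structures.
From mathcomp Require Import all_boot all_order all_algebra.
From mathcomp Require Import all_classical all_reals all_analysis.

Set Implicit Arguments.
Unset Strict Implicit.
Unset Printing Implicit Defensive.

Import Order.TTheory GRing.Theory Num.Theory.
Import numFieldNormedType.Exports.
Local Open Scope classical_set_scope.
Local Open Scope ring_scope.

Section Smooth.
Context {R : realType} {V W : normedModType R}.

(* C^r on A; only used for open A, where continuity and differentiability at
   the points of A do not depend on the values of f outside A. *)
Fixpoint Ck (r : nat) (A : set V) (f : V -> W) : Prop :=
  match r with
  | 0 => forall x, A x -> {for x, continuous f}
  | s.+1 => (forall x, A x -> differentiable f x) /\
            (forall h : V, Ck s A (fun x => 'd f x h))
  end.

Definition smooth_on (A : set V) (f : V -> W) := forall r, Ck r A f.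

End Smooth.

(* A homeomorphism of the open set [source] onto an open subset of R^m.
   [param] is its inverse; both are total functions with irrelevant values
   outside [source] and its image. *)
Record chart (R : realType) (T : topologicalType) (m : nat) := Chart {
  source : set T;
  coord : T -> 'rV[R]_m;
  param : 'rV[R]_m -> T;
  source_open : open source;
  target_open : open (coord @` source);
  coordK : forall q, source q -> param (coord q) = q;
  coord_continuous : forall q, source q -> {for q, continuous coord};
  param_continuous :
    forall u, (coord @` source) u -> {for u, continuous param} }.

(* A smooth manifold, its structure being given by an atlas indexed by the
   points: any atlas contains a subatlas of this form. *)
Record manifold (R : realType) (m : nat) := Manifold {
  carrier :> topologicalType;
  chart_at : carrier -> chart R carrier m;
  carrier_hausdorff : hausdorff_space carrier;
  carrier_second_countable : @second_countable carrier;
  chart_at_source : forall p, source (chart_at p) p;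
  chart_at_compatible : forall p q,
    smooth_on (coord (chart_at p) @` (source (chart_at p) `&`
                                      source (chart_at q)))
              (coord (chart_at q) \o param (chart_at p)) }.

(* The tangent space T_p M is represented by 'rV[R]_m: a tangent vector at p
   is identified with its components in the chart [chart_at p].  A vector
   field is thus a function M -> 'rV[R]_m, but its values at different points
   are components in different charts. *)
Section Manifold.
Context {R : realType} {m : nat} {M : manifold R m}.
Implicit Types (p q : M) (x y z : 'rV[R]_m) (X Y Z : M -> 'rV[R]_m).

Definition src p : set M := source (chart_at p).
Definition crd p : M -> 'rV[R]_m := coord (chart_at p).
Definition prm p : 'rV[R]_m -> M := param (chart_at p).

(* components in [chart_at p] of the vector x of T_q M *)
Definition components p q x : 'rV[R]_m := 'd (crd p \o prm q) (crd q q) x.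

(* the vector field on [src p] with constant components x in [chart_at p];
   its value at p is x *)
Definition const_field p x : M -> 'rV[R]_m :=
  fun q => 'd (crd q \o prm p) (crd p q) x.

Definition smooth_fun_on (U : set M) (f : M -> R) :=
  forall p, smooth_on (crd p @` (U `&` src p)) (f \o prm p).

Definition local_rep p X : 'rV[R]_m -> 'rV[R]_m :=
  fun u => components p (prm p u) (X (prm p u)).

Definition smooth_field_on (U : set M) X :=
  forall p, smooth_on (crd p @` (U `&` src p)) (local_rep p X).

Definition smooth_fun_near p f := exists2 U, open_nbhs p U & smooth_fun_on U f.
Definition smooth_field_near p X :=
  exists2 U, open_nbhs p U & smooth_field_on U X.

Definition dfun (f : M -> R) p x : R := 'd (f \o prm p) (crd p p) x.

Definition lie_bracket X Y : M -> 'rV[R]_m := fun p =>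
  'd (local_rep p Y) (crd p p) (X p) - 'd (local_rep p X) (crd p p) (Y p).

End Manifold.

(* [gram p] is the Gram matrix of the metric on T_p M. *)
Record riemannian_metric (R : realType) (m : nat) (M : manifold R m) :=
  RiemannianMetric {
  gram : M -> 'M[R]_m;
  gram_sym : forall p, (gram p)^T = gram p;
  gram_posdef : forall p (x : 'rV[R]_m),
    x != 0 -> 0 < (x *m gram p *m x^T) 0 0;
  gram_smooth : forall p (x y : 'rV[R]_m),
    smooth_fun_on (src p)
      (fun q => (const_field p x q *m gram q *m (const_field p y q)^T) 0 0) }.

Section Riemannian.
Context {R : realType} {m : nat} {M : manifold R m} (g : riemannian_metric M).
Implicit Types (p q : M) (x y z : 'rV[R]_m) (X Y Z : M -> 'rV[R]_m).

Definition inner p x y : R := (x *m gram g p *m y^T) 0 0.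

(* the vector x of T_p M such that inner p x y = alpha y for all y, for a
   linear form alpha on T_p M *)
Definition sharp p (alpha : 'rV[R]_m -> R) : 'rV[R]_m :=
  (\row_i alpha (delta_mx 0 i)) *m invmx (gram g p).

Definition orthonormal_vectors p d (F : 'I_d -> 'rV[R]_m) :=
  forall i j, inner p (F i) (F j) = (i == j)%:R.

Definition orthonormal_frame_on (U : set M) (E : 'I_m -> M -> 'rV[R]_m) :=
  (forall i, smooth_field_on U (E i)) /\
  (forall q, U q -> orthonormal_vectors q (E ^~ q)).

(* [nabla p x Y] is the value at p of the covariant derivative of Y in the
   direction x of T_p M; it is meaningful for Y smooth near p. *)
Definition connection := forall p : M, 'rV[R]_m -> (M -> 'rV[R]_m) -> 'rV[R]_m.

Record is_connection (nabla : connection) : Prop := {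
  connection_linear : forall p (a : R) x y Y, smooth_field_near p Y ->
    nabla p (a *: x + y) Y = a *: nabla p x Y + nabla p y Y;
  connectionD : forall p x Y Z,
    smooth_field_near p Y -> smooth_field_near p Z ->
    nabla p x (Y \+ Z) = nabla p x Y + nabla p x Z;
  connection_leibniz : forall p x f Y,
    smooth_fun_near p f -> smooth_field_near p Y ->
    nabla p x (fun q => f q *: Y q) = dfun f p x *: Y p + f p *: nabla p x Y;
  connection_smooth : forall U X Y, open U ->
    smooth_field_on U X -> smooth_field_on U Y ->
    smooth_field_on U (fun q => nabla q (X q) Y) }.

Record is_levi_civita (nabla : connection) : Prop := {
  levi_civita_connection : is_connection nabla;
  levi_civita_torsion_free : forall p X Y,
    smooth_field_near p X -> smooth_field_near p Y ->
    nabla p (X p) Y - nabla p (Y p) X = lie_bracket X Y p;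
  levi_civita_metric : forall p x Y Z,
    smooth_field_near p Y -> smooth_field_near p Z ->
    dfun (fun q => inner q (Y q) (Z q)) p x =
    inner p (nabla p x Y) (Z p) + inner p (Y p) (nabla p x Z) }.

Section Curvature.
Variable nabla : connection.

Definition curvature X Y Z : M -> 'rV[R]_m := fun p =>
  nabla p (X p) (fun q => nabla q (Y q) Z) -
  nabla p (Y p) (fun q => nabla q (X q) Z) -
  nabla p (lie_bracket X Y p) Z.

(* R(x,y)z for tangent vectors at p: by tensoriality any local extensions of
   x, y, z to vector fields give the same value. *)
Definition Rm_op p x y z : 'rV[R]_m :=
  curvature (const_field p x) (const_field p y) (const_field p z) p.

Definition Rm p w x y z : R := inner p (Rm_op p w x y) z.

(* F is meant to be an orthonormal basis of T_p M. *)
Definition ricci p (F : 'I_m -> 'rV[R]_m) x y : R := \sum_a Rm p (F a) x y (F a).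

Definition ricci_op p F x : 'rV[R]_m := sharp p (ricci p F x).

End Curvature.
End Riemannian.

Arguments connection {R m} M.

Section Maps.
Context {R : realType} {n m : nat} {M : manifold R n} {Mt : manifold R m}.
Variable f : M -> Mt.
Implicit Types (p q : M) (x y : 'rV[R]_n) (V : M -> 'rV[R]_m).

Definition smooth_map := continuous f /\ forall p (b : Mt),
  smooth_on (crd p @` (src p `&` f @^-1` src b)) (crd b \o f \o prm p).

Definition tangent_map p x : 'rV[R]_m :=
  'd (crd (f p) \o f \o prm p) (crd p p) x.

Record is_embedding : Prop := {
  embedding_smooth : smooth_map;
  embedding_immersion : forall p, injective (tangent_map p);
  embedding_injective : injective f;
  embedding_topological : forall U : set M, open U ->
    exists2 V : set Mt, open V & f @^-1` V = U }.

(* A vector field along f is a function V with V q in T_(f q) Mt. *)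
Definition local_rep_along p (b : Mt) V : 'rV[R]_n -> 'rV[R]_m :=
  fun u => components b (f (prm p u)) (V (prm p u)).

Definition smooth_along_on (U : set M) V := forall p (b : Mt),
  smooth_on (crd p @` (U `&` src p `&` f @^-1` src b)) (local_rep_along p b V).

(* The derivative of V in the direction x of T_p M: writing V = V^a d_a in the
   chart at f p, it is dV^a(x) d_a + V^a nabla_(df x) d_a.  It is equal to
   nabla_(df x) V' for any extension V' of V to a neighborhood of f p. *)
Definition cov_along (nabla : connection Mt) p x V : 'rV[R]_m :=
  'd (local_rep_along p (f p) V) (crd p p) x +
  \sum_a V p 0 a *:
    nabla (f p) (tangent_map p x) (const_field (f p) (delta_mx 0 a)).

End Maps.

Section Submanifold.
Context {R : realType} {n m : nat} {M : manifold R n} {Mt : manifold R m}.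
Variables (g : riemannian_metric M) (gt : riemannian_metric Mt).
Variables (iota : M -> Mt) (nabla : connection Mt).
Implicit Types (p q : M) (x y : 'rV[R]_n) (w eta : 'rV[R]_m).

Definition is_riemannian_submanifold :=
  is_embedding iota /\
  forall p x y,
    inner g p x y = inner gt (iota p) (tangent_map iota p x)
                                      (tangent_map iota p y).

(* the vector of T_p M whose image in T_(iota p) Mt is the orthogonal
   projection of w *)
Definition tangent_part p w : 'rV[R]_n :=
  sharp g p (fun y => inner gt (iota p) w (tangent_map iota p y)).

Definition normal_part p w : 'rV[R]_m :=
  w - tangent_map iota p (tangent_part p w).

(* The value depends on y only, not on its extension. *)
Definition second_form p x y : 'rV[R]_m :=
  normal_part p
    (cov_along iota nabla p x
       (fun q => tangent_map iota q (const_field p y q))).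

Definition weingarten p eta x : 'rV[R]_n :=
  sharp g p (fun y => inner gt (iota p) eta (second_form p x y)).

Definition mean_curvature_vector (E : 'I_n -> M -> 'rV[R]_n) p : 'rV[R]_m :=
  n%:R^-1 *: \sum_i second_form p (E i p) (E i p).

Definition mean_curvature p eta : R :=
  n%:R^-1 * \tr (lin1_mx (weingarten p eta)).

Definition normal_frame_on k (U : set M) (N : 'I_k -> M -> 'rV[R]_m) :=
  [/\ forall l, smooth_along_on iota U (N l),
      forall q, U q -> forall l y,
        inner gt (iota q) (N l q) (tangent_map iota q y) = 0 &
      forall q, U q -> orthonormal_vectors gt (iota q) (N ^~ q)].

(* vt is a smooth vector field near iota p in Mt extending v *)
Definition extends_near p (v : M -> 'rV[R]_n) (vt : Mt -> 'rV[R]_m) :=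
  exists2 U : set Mt, open_nbhs (iota p) U &
    smooth_field_on U vt /\
    (forall q, U (iota q) -> vt (iota q) = tangent_map iota q (v q)).

End Submanifold.

Section Euclidean.
Context (R : realType) (m : nat).

Lemma id_image_open : open (id @` [set: 'rV[R]_m]).
Proof. by rewrite image_id; exact: openT. Qed.

Definition euclidean_chart : chart R 'rV[R]_m m :=
  @Chart R 'rV[R]_m m setT id id openT id_image_open (fun _ _ => erefl)
    (fun _ _ _ => id) (fun _ _ _ => id).

Lemma second_countable_rV : @second_countable 'rV[R]_m.
Proof.
pose B (z : 'rV[rat]_m * nat) : set 'rV[R]_m :=
  ball (map_mx ratr z.1 : 'rV[R]_m) (z.2.+1%:R^-1 : R).
exists (B @` setT).
  exact: card_le_trans (card_image_le _ _) (countableP _).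
split=> [_ [z _ <-]|x A /nbhs_ballP[e /= e0 xA]]; first exact: ball_open.
have [k _ /(_ _ (leqnn k))/= ke] :=
  near_infty_natSinv_lt (PosNum (divr_gt0 e0 (ltr0n _ 2))).
have k0 : 0 < k.+1%:R^-1 :> R by rewrite invr_gt0.
have /choice[v xv] i : exists a : rat, `|x 0 i - ratr a| < k.+1%:R^-1.
  have /rat_in_itvoo[a] : x 0 i - k.+1%:R^-1 < x 0 i + k.+1%:R^-1.
    by rewrite ltrD2l gt0_cp.
  by rewrite in_itv/= => xa; exists a; rewrite distrC ltr_distl.
have xB : ball (map_mx ratr (\row_i v i) : 'rV[R]_m) (k.+1%:R^-1 : R) x.
  split=> // i j; rewrite !mxE /ball/= distrC ord1; exact: xv.
exists (B (\row_i v i, k)); first by split; [exists (\row_i v i, k)|].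
move=> y yB; apply: xA; apply: le_ball (ball_triangle (ball_sym xB) yB).
by rewrite (splitr e) lerD// ltW.
Qed.

Lemma Ck_cst (V W : normedModType R) r (A : set V) (c : W) :
  Ck r A (fun=> c).
Proof.
elim: r c => [|r IH] c /=; first by move=> x _; exact: cst_continuous.
split=> [x _|h]; first exact: differentiable_cst.
suff -> : (fun x => 'd (fun=> c) x h) = (fun=> 0 : W) by exact: IH.
by apply/funext => x; rewrite diff_cst.
Qed.

Lemma diff_idE (V : normedModType R) (x h : V) : 'd id x h = h.
Proof. by rewrite diff_val. Qed.

Lemma smooth_on_id (V : normedModType R) (A : set V) : smooth_on A id.
Proof.
case=> [|r] /=; first by move=> x _ B.
split=> [x _|h]; first exact: ex_diff.
suff -> : (fun x : V => 'd id x h) = (fun=> h) by exact: Ck_cst.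
by apply/funext => x; rewrite diff_idE.
Qed.

Definition euclidean_space : manifold R m :=
  @Manifold R m 'rV[R]_m (fun=> euclidean_chart)
    (@norm_hausdorff _ _) second_countable_rV (fun=> I)
    (fun _ _ => smooth_on_id _).

Definition euclidean_metric : riemannian_metric euclidean_space.
Proof.
refine (@RiemannianMetric R m euclidean_space (fun=> 1%:M) _ _ _).
- by move=> _; rewrite trmx1.
- move=> _ x x0; rewrite mulmx1 mxE.
  have [i xi0] : exists i, x 0 i != 0 by apply/rV0Pn.
  rewrite (bigD1 i)//= mxE -expr2 ltr_pwDl//.
    by rewrite lt_neqAle eq_sym sqrf_eq0 xi0 sqr_ge0.
  by apply: sumr_ge0 => j _; rewrite mxE -expr2 sqr_ge0.
- move=> p x y q r /=.
  rewrite (_ : _ \o _ = cst ((x *m 1%:M *m y^T) 0 0)); first exact: Ck_cst.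
  by apply/funext => u; rewrite /= /const_field !diff_idE.
Defined.

End Euclidean.

(* Main.v *)
Require Import Defs.
From HB Require Import structures.
From mathcomp Require Import all_boot all_order all_algebra.
From mathcomp Require Import all_classical all_reals all_analysis.
From mathcomp Require Import ring lra.

Set Implicit Arguments.
Unset Strict Implicit.
Unset Printing Implicit Defensive.

Import Order.TTheory GRing.Theory Num.Theory.
Import numFieldNormedType.Exports.
Local Open Scope classical_set_scope.
Local Open Scope ring_scope.

(** The Ricci formula is the trace of the Gauss equation.  Choose at p the
    orthonormal basis of the ambient tangent space made of the E_i and the
    N_l.  For y tangent at p, the number Ric~(v, y) is the sum of
    R~(E_i, v, y, E_i) over i and of R~(N_l, v, y, N_l) over l.  The second
    sum appears in the formula up to the symmetries of R~.  In the first sum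
    the Gauss equation replaces each term by
      R(E_i, v, y, E_i) + <II(E_i, y), II(v, E_i)> - <II(v, y), II(E_i, E_i)>.
    Summed over i these give Ric(v, y), then, after expanding the normal
    vectors II(E_i, y) in the N_l, the sum of <W_l v, W_l y>, and finally
    - n <H, II(v, y)>.  This is linear algebra in the tangent spaces at p,
    where traces do not depend on the orthonormal basis ([bilinear_trace],
    [trace_orthonormal]).  The computation is [ricci_gauss] and
    [tangent_part_ricci_op].

    The Gauss equation is proved in one chart of each manifold
    ([coordinate_gauss_equation]) and carried to the manifolds by
    [curvature_in_chart] and [second_form_coordinate].  In charts the
    connections are Christoffel symbols, the embedding is a smooth map f
    between open subsets of R^n and R^m, and vector fields along f have the
    covariant derivative D_h X = dX(h) + Gamma~(df h, X).  Three facts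
    suffice.
    - Second derivatives commute ([schwarz]).  This makes D_h (df z) symmetric
      in h and z, and makes the commutator of D_k and D_h on df z equal to
      R~(df k, df h) df z ([cov_dir_commutator]).
    - The tangential part of D_h (df z) is df (Gamma(h, z)), because
      both satisfy the symmetry and the metric identity which, by Koszul's
      argument, have a single solution ([koszul_unique]).  So
      II(h, z) = D_h (df z) - df (Gamma(h, z)) is normal at every point of
      the chart.
    - Differentiating <II(h, z), df w> = 0 turns the tangential part of
      D_k II(h, z) into - <II(h, z), II(k, w)>.

    The passage from the manifolds to charts rests on the chain rule and on
    the locality of connections.  The latter follows from the Leibniz rule
    applied to the indicator function of a neighborhood, which is smooth near
    the point ([connection_local]).

    In Euclidean space Koszul's argument also shows that the Christoffel
    symbols of any Levi-Civita connection vanish, because the metric has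
    constant coefficients; hence R~ = 0 ([euclidean_flat]). *)

(** * Rules of differentiation *)

Section DifferentialRules.
Context {R : realType}.
Implicit Types (V W : normedModType R).

(** Differentials are local.  The difference of the two functions vanishes
    near the point, hence is a little-o of anything, so that its differential
    is 0; the sum rule does the rest. *)
Lemma near_eq_is_diff V W (f g df : V -> W) (x : V) :
  (\forall z \near x, f z = g z) -> is_diff x f df -> is_diff x g df.
Proof.
move=> fg fd.
have nz : is_diff x (g - f) (0 : V -> W).
  have e : (g - f) \o shift x = cst ((g - f) x) + (0 : V -> W) +o_ 0 id.
    rewrite (_ : cst _ + _ = 0); last first.
      apply/funext => z /=; rewrite !fctE /= addr0.
      by rewrite (nbhs_singleton fg) subrr.
    apply: eqaddoE; rewrite add0r.
    apply/eqoP => _ /posnumP[e].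
    have : \forall z \near (0 : V), f (z + x) = g (z + x).
      by move: fg; rewrite (near_shift 0) subr0.
    apply: filterS => z fgz; rewrite !fctE /= fgz subrr normr0.
    by rewrite mulr_ge0.
  have c0 : continuous (0 : V -> W) by move=> z; exact: cst_continuous.
  have dE : 'd (g - f) x = (0 : V -> W) :> (V -> W).
    exact: (@diff_unique _ _ _ _ (\0%R : {linear V -> W})).
  by apply: DiffDef => //; apply/diff_locallyP; rewrite dE.
have -> : g = f + (g - f) by rewrite addrC subrK.
have -> : df = df + (0 : V -> W) by rewrite addr0.
exact: is_diffD.
Qed.

Lemma is_diff_sum V W n (f df : 'I_n -> V -> W) (x : V) :
  (forall i, is_diff x (f i) (df i)) ->
  is_diff x (fun z => \sum_i f i z) (fun h => \sum_i df i h).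
Proof.
move=> fd.
rewrite (_ : (fun z => _) = \sum_i f i); last by apply/funext => z; rewrite fct_sumE.
rewrite (_ : (fun h => _) = \sum_i df i); last by apply/funext => z; rewrite fct_sumE.
apply: (big_ind2 (fun f df => is_diff x f df)) => //; first exact: is_diff_cst.
by move=> *; exact: is_diffD.
Qed.

Lemma is_diff_coord V n (X dX : V -> 'rV[R]_n) (x : V) (a : 'I_n) :
  is_diff x X dX -> is_diff x (fun z => X z 0 a) (fun h => dX h 0 a).
Proof.
move=> Xd.
pose c (N : 'rV[R]_n) := N 0 a.
have cl : linear c by move=> k u v; rewrite /c !mxE.
pose clM := GRing.isLinear.Build _ _ _ _ _ cl.
pose cL : {linear 'rV[R]_n -> R} := HB.pack c clM.
have cc : continuous cL by exact: coord_continuous.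
have dc : is_diff (X x) (cL : _ -> _) (cL : _ -> _).
  by apply: DiffDef; [exact: linear_differentiable | rewrite diff_lin].
exact: (is_diff_comp Xd dc).
Qed.

(** Scaling is a continuous bilinear map, composed here with the pair of the
    two functions. *)
Lemma is_diff_scale V W (a da : V -> R) (f df : V -> W) (x : V) :
  is_diff x a da -> is_diff x f df ->
  is_diff x (fun z => a z *: f z) (fun h => da h *: f x + a x *: df h).
Proof.
move=> ad fd.
have sb : bilinear_for
    (GRing.Scale.Law.clone _ _ *:%R _) (GRing.Scale.Law.clone _ _ *:%R _)
    (fun (k : R) (w : W) => k *: w).
  split=> [w k u v|k c u v] /=; first by rewrite scalerDl scalerA.
  by rewrite scalerDr !scalerA mulrC.
pose sbM := bilinear_isBilinear.Build R R W W _ _ _ sb.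
pose sL : {bilinear R -> W -> W} := HB.pack (fun (k : R) (w : W) => k *: w) sbM.
have sc : continuous (fun p : R * W => sL p.1 p.2).
  by move=> p; exact: scale_continuous.
have ds : is_diff (a x, f x) (fun p : R * W => sL p.1 p.2)
   (fun p : R * W => sL (a x) p.2 + sL p.1 (f x)).
  by apply: DiffDef; [exact: differentiable_bilin | rewrite diff_bilin].
apply: is_diff_eq (is_diff_comp (is_diff_pair ad fd) ds) _.
by apply/funext => h /=; rewrite addrC.
Qed.

Lemma linear_row_sum (W : lmodType R) n (L : 'rV[R]_n -> W) (x : 'rV[R]_n) :
  linear L -> L x = \sum_a x 0 a *: L (delta_mx 0 a).
Proof.
move=> Ll; pose LM := GRing.isLinear.Build _ _ _ _ _ Ll.
pose L' : {linear 'rV[R]_n -> W} := HB.pack L LM.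
rewrite -[L]/(L' : _ -> _) [in LHS](row_sum_delta x) linear_sum.
by apply: eq_bigr => i _; rewrite linearZ.
Qed.

(** A family of linear maps depending differentiably on a parameter, applied
    to a differentiable argument, obeys the product rule.  Continuity of the
    linear maps is automatic because the argument is finite-dimensional. *)
Lemma is_diff_apply V W n (L : V -> 'rV[R]_n -> W) (X dX : V -> 'rV[R]_n)
    (x : V) :
  (\forall z \near x, linear (L z)) ->
  (forall y, differentiable (L ^~ y) x) -> is_diff x X dX ->
  is_diff x (fun z => L z (X z))
    (fun h => 'd (L ^~ (X x)) x h + L x (dX h)).
Proof.
move=> Ll Ld Xd.
have Lx : linear (L x) by exact: nbhs_singleton Ll.
have Li y : is_diff x (L ^~ y) ('d (L ^~ y) x) by exact: differentiableP.
have dL y h : 'd (L ^~ y) x h =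
    \sum_a y 0 a *: 'd (L ^~ (delta_mx 0 a)) x h.
  have /(@diff_val _ _ _ _ _ _ _) -> // : is_diff x (L ^~ y)
      (fun h => \sum_a y 0 a *: 'd (L ^~ (delta_mx 0 a)) x h).
  apply: (near_eq_is_diff (f := fun z => \sum_a y 0 a *: L z (delta_mx 0 a))).
    by apply: filterS Ll => z Lz; rewrite -linear_row_sum.
  by apply: is_diff_sum => i; exact: is_diffZ.
apply: (near_eq_is_diff
  (f := fun z => \sum_a X z 0 a *: L z (delta_mx 0 a))).
  by apply: filterS Ll => z Lz; rewrite -linear_row_sum.
apply: is_diff_eq
  (is_diff_sum (fun i => is_diff_scale (is_diff_coord i Xd) (Li _))) _.
apply/funext => h; rewrite big_split /= addrC; congr (_ + _); first by rewrite dL.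
by rewrite [RHS](linear_row_sum _ Lx).
Qed.

Lemma is_diff_fun_eq V W (f df : V -> W) x h : is_diff x f df -> 'd f x h = df h.
Proof. by move=> fd; rewrite diff_val. Qed.

Lemma near_eq_differentiable V W (f g : V -> W) (x : V) :
  (\forall z \near x, f z = g z) -> differentiable f x -> differentiable g x.
Proof. by move=> fg /differentiableP /(near_eq_is_diff fg) []. Qed.

Lemma near_eq_diff V W (f g : V -> W) (x h : V) :
  (\forall z \near x, f z = g z) -> differentiable f x -> 'd f x h = 'd g x h.
Proof.
by move=> fg /differentiableP /(near_eq_is_diff fg)/is_diff_fun_eq ->.
Qed.

Lemma diffDE V W (f g : V -> W) (x h : V) :
  differentiable f x -> differentiable g x ->
  'd (fun z => f z + g z) x h = 'd f x h + 'd g x h.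
Proof. by move=> fd gd; rewrite (_ : (fun z => _) = f + g)// diffD. Qed.

Lemma diffBE V W (f g : V -> W) (x h : V) :
  differentiable f x -> differentiable g x ->
  'd (fun z => f z - g z) x h = 'd f x h - 'd g x h.
Proof. by move=> fd gd; rewrite (_ : (fun z => _) = f - g)// diffB. Qed.

Lemma diff_scaleE V W (a : V -> R) (f : V -> W) (x h : V) :
  differentiable a x -> differentiable f x ->
  'd (fun z => a z *: f z) x h = 'd a x h *: f x + a x *: 'd f x h.
Proof.
move=> /differentiableP ad /differentiableP fd.
by rewrite (is_diff_fun_eq _ (is_diff_scale ad fd)).
Qed.

Lemma diff_coordE V n (X : V -> 'rV[R]_n) (x h : V) a :
  differentiable X x -> 'd (fun z => X z 0 a) x h = 'd X x h 0 a.
Proof.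
by move=> /differentiableP Xd; rewrite (is_diff_fun_eq _ (is_diff_coord a Xd)).
Qed.

Lemma diff_applyE V W n (L : V -> 'rV[R]_n -> W) (X : V -> 'rV[R]_n) (x h : V) :
  (\forall z \near x, linear (L z)) ->
  (forall y, differentiable (L ^~ y) x) -> differentiable X x ->
  'd (fun z => L z (X z)) x h = 'd (L ^~ (X x)) x h + L x ('d X x h).
Proof.
move=> Ll Ld /differentiableP Xd.
by rewrite (is_diff_fun_eq _ (is_diff_apply Ll Ld Xd)).
Qed.

Lemma diff_compE V (U : normedModType R) W (f : V -> U) (g : U -> W) (x h : V) :
  differentiable f x -> differentiable g (f x) ->
  'd (g \o f) x h = 'd g (f x) ('d f x h).
Proof. by move=> fd gd; rewrite diff_comp. Qed.

End DifferentialRules.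

(** * Operations on functions of class C^r *)

Section SmoothFunctions.
Context {R : realType}.
Implicit Types (V W : normedModType R) (r : nat).

Lemma Ck_sub V W r (A B : set V) (f : V -> W) :
  A `<=` B -> Ck r B f -> Ck r A f.
Proof.
move=> AB; elim: r f => [|r IH] f /=; first by move=> fB x /AB /fB.
by case=> fB dB; split=> [x /AB /fB //|h]; exact: IH.
Qed.

Lemma Ck_ext V W r (A : set V) (f g : V -> W) :
  open A -> (forall x, A x -> f x = g x) -> Ck r A f -> Ck r A g.
Proof.
move=> oA.
have near_of (f' g' : V -> W) x : (forall x, A x -> f' x = g' x) -> A x ->
    \forall z \near x, f' z = g' z.
  by move=> fg Ax; apply: filterS fg _; exact: open_nbhs_nbhs.
elim: r f g => [|r IH] f g fg /=.
  move=> fA x Ax; change (g @ x --> g x); rewrite -fg//.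
  apply: cvg_trans (fA _ Ax); apply: near_eq_cvg.
  by have := near_of _ _ _ fg Ax; apply: filterS => z ->.
case=> fA dA; split=> [x Ax|h].
  exact: near_eq_differentiable (near_of _ _ _ fg Ax) (fA _ Ax).
apply: IH (dA h) => x Ax; apply: near_eq_diff; [exact: near_of | exact: fA].
Qed.

Lemma CkW V W r (A : set V) (f : V -> W) : Ck r.+1 A f -> Ck r A f.
Proof.
elim: r f => [|r IH] f /= [fA dA].
  by move=> x Ax; exact/differentiable_continuous/fA.
by split=> // h; exact: IH (dA h).
Qed.

Lemma CkD V W r (A : set V) (f g : V -> W) : open A ->
  Ck r A f -> Ck r A g -> Ck r A (fun x => f x + g x).
Proof.
move=> oA; elim: r f g => [|r IH] f g /=.
  by move=> fA gA x Ax; apply: continuousD; [exact: fA|exact: gA].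
case=> fA dfA [gA dgA]; split=> [x Ax|h].
  by apply: differentiableD; [exact: fA|exact: gA].
apply: Ck_ext (IH _ _ (dfA h) (dgA h)) => // x Ax.
by rewrite diffDE//; [exact: fA|exact: gA].
Qed.

Lemma Ck_sum V W r (A : set V) n (f : 'I_n -> V -> W) : open A ->
  (forall i, Ck r A (f i)) -> Ck r A (fun x => \sum_i f i x).
Proof.
move=> oA fA.
rewrite (_ : (fun z => _) = \sum_i f i); last by apply/funext => z; rewrite fct_sumE.
by apply: (big_ind (Ck r A)) => //; [exact: Ck_cst | move=> *; exact: CkD].
Qed.

Lemma Ck_scale V W r (A : set V) (a : V -> R) (f : V -> W) : open A ->
  Ck r A a -> Ck r A f -> Ck r A (fun x => a x *: f x).
Proof.
move=> oA; elim: r a f => [|r IH] a f /=.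
  by move=> aA fA x Ax; apply: continuousZ; [exact: aA|exact: fA].
move=> aA' fA'; have [aA daA] := aA'; have [fA dfA] := fA'.
split=> [x Ax|h].
  have [//] := is_diff_scale (differentiableP (aA _ Ax)) (differentiableP (fA _ Ax)).
apply: (@Ck_ext _ _ _ _ (fun x => 'd a x h *: f x + a x *: 'd f x h)) => // [x Ax|].
  by rewrite diff_scaleE//; [exact: aA|exact: fA].
by apply: CkD => //; apply: IH => //; apply: CkW.
Qed.

Lemma Ck_coord V r (A : set V) n (X : V -> 'rV[R]_n) a : open A ->
  Ck r A X -> Ck r A (fun x => X x 0 a).
Proof.
move=> oA; elim: r X => [|r IH] X /=.
  move=> XA x Ax; apply: (@continuous_comp _ _ _ X (fun N : 'rV[R]_n => N 0 a)).
    exact: XA.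
  exact: coord_continuous.
case=> XA dXA; split=> [x Ax|h].
  by have [] := is_diff_coord a (differentiableP (XA _ Ax)).
apply: Ck_ext (IH _ (dXA h)) => // x Ax; rewrite diff_coordE//; exact: XA.
Qed.

(** Expanding the argument in the canonical basis reduces this to products
    with scalar functions. *)
Lemma Ck_apply V W r (A : set V) n (L : V -> 'rV[R]_n -> W)
    (X : V -> 'rV[R]_n) : open A ->
  (forall z, A z -> linear (L z)) -> (forall y, Ck r A (L ^~ y)) ->
  Ck r A X -> Ck r A (fun z => L z (X z)).
Proof.
move=> oA Ll LA XA.
apply: (@Ck_ext _ _ _ _ (fun z => \sum_a X z 0 a *: L z (delta_mx 0 a))) => //.
  by move=> z /Ll Lz; rewrite -linear_row_sum.
by apply: Ck_sum => // i; apply: Ck_scale => //; exact: Ck_coord.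
Qed.

(** By induction on r: the derivative of g o f in a direction h is the linear
    map dg at f x applied to df(h), and both the map and its argument are of
    class C^(r-1), the former by the induction hypothesis. *)
Lemma Ck_comp V W n r (A : set V) (B : set 'rV[R]_n) (f : V -> 'rV[R]_n)
    (g : 'rV[R]_n -> W) : open A -> open B -> (forall x, A x -> B (f x)) ->
  Ck r A f -> Ck r B g -> Ck r A (g \o f).
Proof.
move=> oA oB fAB; elim: r g => [|r IH] g.
  by move=> fA gB x Ax; apply: continuous_comp; [exact: fA|exact/gB/fAB].
move=> fA' gB'; have [fA dfA] := fA'; have [gB dgB] := gB'.
split=> [x Ax|h].
  by apply: differentiable_comp; [exact: fA|exact/gB/fAB].
apply: (@Ck_ext _ _ _ _ (fun x => 'd g (f x) ('d f x h))) => // [x Ax|].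
  by apply/esym/diff_compE; [exact: fA|exact/gB/fAB].
apply: (@Ck_apply _ _ _ _ _ (fun x => 'd g (f x))) => //.
- by move=> z _; exact: linearP.
- by move=> y; exact: (IH (fun u => 'd g u y) (CkW fA') (dgB y)).
- exact: dfA.
Qed.

Lemma smooth_differentiable V W (A : set V) (f : V -> W) x :
  smooth_on A f -> A x -> differentiable f x.
Proof. by move=> /(_ 1%N) [fA _] /fA. Qed.

Lemma smooth_diff V W (A : set V) (f : V -> W) h :
  smooth_on A f -> smooth_on A (fun x => 'd f x h).
Proof. by move=> fA r; have [_] := fA r.+1; exact. Qed.

Lemma smooth_sub V W (A B : set V) (f : V -> W) :
  A `<=` B -> smooth_on B f -> smooth_on A f.
Proof. by move=> AB fB r; exact: Ck_sub (fB r). Qed.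

Lemma smooth_ext V W (A : set V) (f g : V -> W) :
  open A -> (forall x, A x -> f x = g x) -> smooth_on A f -> smooth_on A g.
Proof. by move=> oA fg fA r; exact: Ck_ext (fA r). Qed.

Lemma smooth_comp V W n (A : set V) (B : set 'rV[R]_n) (f : V -> 'rV[R]_n)
    (g : 'rV[R]_n -> W) : open A -> open B -> (forall x, A x -> B (f x)) ->
  smooth_on A f -> smooth_on B g -> smooth_on A (g \o f).
Proof. by move=> oA oB fAB fA gB r; exact: Ck_comp (fA r) (gB r). Qed.

Lemma smooth_apply V W (A : set V) n (L : V -> 'rV[R]_n -> W)
    (X : V -> 'rV[R]_n) : open A ->
  (forall z, A z -> linear (L z)) -> (forall y, smooth_on A (L ^~ y)) ->
  smooth_on A X -> smooth_on A (fun z => L z (X z)).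
Proof. by move=> oA Ll LA XA r; apply: Ck_apply => // y; exact: LA. Qed.

End SmoothFunctions.

(** * Symmetry of second derivatives *)

Section Schwarz.
Context {R : realType}.
Implicit Types (V W : normedModType R).

Lemma MVT_line V (F : V -> R) (y v : V) (s : R) : 0 < s ->
  (forall t, 0 <= t <= s -> differentiable F (y + t *: v)) ->
  exists2 t, 0 <= t <= s & F (y + s *: v) - F y = s * 'd F (y + t *: v) v.
Proof.
move=> s0 Fd; pose l (t : R) := y + t *: v.
have ld t : is_diff t l (fun k => k *: v).
  apply: is_diff_eq (is_diffD (is_diff_cst y t) (is_diff_scalel t v)) _.
  by apply/funext => k; rewrite !fctE add0r.
have Fld t : 0 <= t <= s -> is_diff t (F \o l) (fun k => k * 'd F (l t) v).
  move=> ts; have Fdl := is_diff_comp (ld t) (differentiableP (Fd _ ts)).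
  by apply: is_diff_eq Fdl _; apply/funext => k /=; rewrite linearZ.
have Flder t : 0 <= t <= s -> is_derive t 1 (F \o l) ('d F (l t) v).
  move=> /Fld [Fl dFl]; apply: DeriveDef; first exact: diff_derivable.
  by rewrite deriveE// dFl mul1r.
have [||t ts] := @MVT _ (F \o l) (fun t => 'd F (l t) v) 0 s s0.
- by move=> t; rewrite in_itv/= => /andP[t0 ts]; apply: Flder; rewrite !ltW.
- apply: derivable_within_continuous => t; rewrite in_itv /= => ts.
  by have [] := Flder _ ts.
rewrite subr0 /= /l scale0r addr0 => ->; exists t; last by rewrite mulrC.
by move: ts; rewrite in_itv/= => /andP[t0 ts]; rewrite !ltW.
Qed.

(** Two applications of the mean value theorem: first to the increment of F in
    the direction k, moved along h, and then to the derivative along h, moved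
    along k.  The second difference on the left is symmetric in h and k. *)
Lemma second_difference V (F : V -> R) (x h k : V) (s : R) : 0 < s ->
  (forall a b : R, 0 <= a <= s -> 0 <= b <= s ->
     differentiable F (x + a *: h + b *: k) /\
     differentiable (fun z => 'd F z h) (x + a *: h + b *: k)) ->
  exists a b : R, [/\ 0 <= a <= s, 0 <= b <= s &
    F (x + s *: h + s *: k) - F (x + s *: h) - F (x + s *: k) + F x =
    s * (s * 'd (fun z => 'd F z h) (x + a *: h + b *: k) k)].
Proof.
move=> s0 Fd; pose F1 z := F (z + s *: k) - F z.
have s1 : 0 <= s <= s by rewrite lexx ltW.
have s2 : (0 : R) <= 0 <= s by apply/andP; split=> //; exact: ltW.
have sh z : is_diff z (fun z => z + s *: k) (id : V -> V).
  apply: is_diff_eq (is_diffD (is_diff_id z) (is_diff_cst (s *: k) z)) _.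
  by apply/funext => u; rewrite !fctE addr0.
have F1d a : 0 <= a <= s -> is_diff (x + a *: h) F1
    (fun u => 'd F (x + a *: h + s *: k) u - 'd F (x + a *: h) u).
  move=> ai; have [d1 _] := Fd _ _ ai s1; have [] := Fd _ _ ai s2.
  rewrite scale0r addr0 => d2 _.
  apply: is_diff_eq
    (is_diffB (is_diff_comp (sh _) (differentiableP d1)) (differentiableP d2)) _.
  by [].
have [|a ai] := @MVT_line _ F1 x h s s0; first by move=> a /F1d [].
rewrite (is_diff_fun_eq _ (F1d _ ai)) /F1 => e.
have [|b bi e'] := @MVT_line _ (fun z => 'd F z h) (x + a *: h) k s s0.
  by move=> b bi; have [] := Fd _ _ ai bi.
exists a, b; split=> //; rewrite -e' -e opprB addrA [RHS]addrAC.
by rewrite -!addrA; congr (_ + _); rewrite addrCA.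
Qed.

(** The two iterated derivatives, taken at suitable points of an arbitrarily
    small parallelogram at x, are the same second difference divided by s^2.
    As both are continuous at x, they agree there. *)
Lemma schwarz_scalar V (A : set V) (F : V -> R) (x h k : V) : open A -> A x ->
  Ck 2 A F -> 'd (fun z => 'd F z h) x k = 'd (fun z => 'd F z k) x h.
Proof.
move=> oA Ax [FA dFA]; set a := LHS; set b := RHS.
apply/eqP; rewrite -subr_eq0; apply: contraT => ab0.
have e0 : 0 < `|a - b| / 2 by rewrite divr_gt0// normr_gt0.
have cont h1 k1 : {for x, continuous (fun z => 'd (fun z => 'd F z h1) z k1)}.
  by have [_ /(_ k1)] := dFA h1; exact.
have near_e h1 k1 : \forall z \near x,
    `|'d (fun z => 'd F z h1) x k1 - 'd (fun z => 'd F z h1) z k1| < `|a - b| / 2.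
  by have /cvgrPdist_lt := cont h1 k1; exact.
have : \forall z \near x, [/\ A z,
    `|a - 'd (fun z => 'd F z h) z k| < `|a - b| / 2 &
    `|b - 'd (fun z => 'd F z k) z h| < `|a - b| / 2].
  have nA : nbhs x A by exact: open_nbhs_nbhs.
  move: nA (near_e h k) (near_e k h); apply: filterS3 => z *; split=> //.
move=> /nbhs_ballP[e /= e0' ball_e].
(* the side s keeps the parallelogram spanned by s h and s k in the ball *)
pose s := e / 2 / (`|h| + `|k| + 1).
have hk : 0 < `|h| + `|k| + 1 by rewrite ltr_wpDl// addr_ge0.
have s0 : 0 < s by rewrite !divr_gt0.
have inball c d : 0 <= c <= s -> 0 <= d <= s -> ball x e (x + c *: h + d *: k).
  move=> /andP[c0 cs] /andP[d0 ds].
  rewrite -ball_normE /= -addrA opprD addNKr normrN.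
  apply: (@le_lt_trans _ _ (s * (`|h| + `|k| + 1))); last first.
    by rewrite /s divfK ?gt_eqF// ltr_pdivrMr// ltr_pMr// ltr1n.
  apply: le_trans (ler_normD _ _) _; rewrite !normrZ !ger0_norm//.
  rewrite !mulrDr mulr1 -[leLHS]addr0 lerD//; last exact: ltW.
  by rewrite lerD// ler_wpM2r.
have dF h1 z : ball x e z -> differentiable (fun z => 'd F z h1) z.
  by move=> /ball_e[Az _ _]; have [+ _] := dFA h1; exact.
have [|c1 [d1 [c1i d1i e1]]] := @second_difference _ F x h k s s0.
  move=> c d ci di; have xe := inball _ _ ci di.
  by split; [have [Az _ _] := ball_e _ xe; exact: FA | exact: dF].
have [|c2 [d2 [c2i d2i e2]]] := @second_difference _ F x k h s s0.
  move=> c d ci di; have xe := inball _ _ di ci; rewrite addrAC.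
  by split; [have [Az _ _] := ball_e _ xe; exact: FA | exact: dF].
have : 'd (fun z => 'd F z h) (x + c1 *: h + d1 *: k) k =
       'd (fun z => 'd F z k) (x + c2 *: k + d2 *: h) h.
  have sn0 : s != 0 by rewrite gt_eqF.
  apply: (mulfI sn0); apply: (mulfI sn0).
  by rewrite -e1 -e2 [x + s *: k + _]addrAC; congr (_ + _); rewrite [LHS]addrAC.
have [_ + _] := ball_e _ (inball _ _ c1i d1i).
have [_ _] := ball_e _ (inball _ _ d2i c2i).
rewrite [x + d2 *: h + _]addrAC => bw au uw; rewrite -uw in bw.
set u := 'd _ (x + c1 *: h + d1 *: k) k in au bw.
suff : `|a - b| < `|a - b| by rewrite ltxx.
apply: le_lt_trans (ler_distD u _ _) _.
by rewrite [ltRHS]splitr ltrD// distrC.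
Qed.

Lemma schwarz V n (A : set V) (F : V -> 'rV[R]_n) (x h k : V) :
  open A -> A x -> smooth_on A F ->
  'd (fun z => 'd F z h) x k = 'd (fun z => 'd F z k) x h.
Proof.
move=> oA Ax FA.
have key i h1 k1 : ('d (fun z => 'd F z h1) x k1) 0 i =
    'd (fun z => 'd (fun z => F z 0 i) z h1) x k1.
  rewrite -diff_coordE; last exact: smooth_differentiable (smooth_diff h1 FA) Ax.
  apply: near_eq_diff.
    apply: (@filterS _ (nbhs x)) (open_nbhs_nbhs (conj oA Ax)) => z Az.
    by rewrite diff_coordE//; exact: smooth_differentiable FA Az.
  have := smooth_differentiable (smooth_diff h1 FA) Ax.
  by move=> /differentiableP /(is_diff_coord i)[].
apply/rowP => i; rewrite !key; apply: (schwarz_scalar h k oA Ax).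
exact: Ck_coord.
Qed.

Lemma smooth_schwarz_scalar V (A : set V) (F : V -> R) (x h k : V) :
  open A -> A x -> smooth_on A F ->
  'd (fun z => 'd F z h) x k = 'd (fun z => 'd F z k) x h.
Proof. by move=> oA Ax FA; exact: schwarz_scalar oA Ax (FA 2%N). Qed.

End Schwarz.

(** * Linear maps and tensor identities *)

Section LinearRules.
Context {R : realType} {V W : lmodType R}.
Implicit Types (L : V -> W).

Lemma linD L x y : linear L -> L (x + y) = L x + L y.
Proof. by move=> Ll; rewrite -[x in LHS]scale1r Ll scale1r. Qed.

Lemma lin0 L : linear L -> L 0 = 0.
Proof. by move=> Ll; apply: (addrI (L 0)); rewrite -linD// !addr0. Qed.

Lemma linZ L a x : linear L -> L (a *: x) = a *: L x.
Proof. by move=> Ll; rewrite -[in LHS](addr0 (a *: x)) Ll lin0// addr0. Qed.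

Lemma linN L x : linear L -> L (- x) = - L x.
Proof. by move=> Ll; rewrite -scaleN1r linZ// scaleN1r. Qed.

Lemma linB L x y : linear L -> L (x - y) = L x - L y.
Proof. by move=> Ll; rewrite linD// linN. Qed.

Lemma lin_sum L n (x : 'I_n -> V) : linear L ->
  L (\sum_i x i) = \sum_i L (x i).
Proof.
move=> Ll; elim/big_rec2: _ => [|i y1 y2 _ <-]; first exact: lin0.
exact: linD.
Qed.

End LinearRules.

Section Tensors.
Context {R : realType} {V : Type}.

(** Koszul's argument: the difference is symmetric in its first two arguments
    and antisymmetric in its last two, so it vanishes. *)
Lemma koszul_unique (S S' : V -> V -> V -> R) :
  (forall h z w, S h z w = S z h w) -> (forall h z w, S' h z w = S' z h w) ->
  (forall h z w, S h z w + S h w z = S' h z w + S' h w z) ->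
  forall h z w, S h z w = S' h z w.
Proof.
move=> Ss S's SS' h z w.
have := SS' h z w; have := SS' z w h; have := SS' w h z.
rewrite (Ss z h) (S's z h) (Ss w h) (S's w h) (Ss w z) (S's w z); lra.
Qed.

(** The octahedron argument: the four cyclic identities obtained by leaving out
    each of a, b, c, d in turn add up to the claim, by the antisymmetries. *)
Lemma curvature_pair_symmetry (T : V -> V -> V -> V -> R) :
  (forall a b c d, T a b c d = - T b a c d) ->
  (forall a b c d, T a b c d = - T a b d c) ->
  (forall a b c d, T a b c d + T b c a d + T c a b d = 0) ->
  forall a b c d, T a b c d = T c d a b.
Proof.
move=> T1 T2 B a b c d.
have := B a b c d; have := B b c d a; have := B c d a b; have := B d a b c.
have := T1 d a b c; have := T1 b d a c; have := T1 c a b d; have := T1 d b c a.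
have := T2 a b c d; have := T2 b c a d; have := T2 a d b c; have := T2 d b a c.
have := T2 c d b a; have := T2 b d c a; have := T2 a c d b; have := T2 c d a b.
have := T1 b c d a; have := T1 c d b a; have := T1 a c d b; have := T1 d a c b.
have := T2 a c b d; have := T2 b d a c; have := T2 d a b c; have := T2 b c d a.
have := T1 a c b d; have := T1 b d c a; have := T1 a d b c; have := T1 a d c b.
lra.
Qed.

End Tensors.

(** * Directional derivatives *)

(** Sealed, so that two directional derivatives are compared through their
    arguments and the choice behind the differential is never unfolded. *)
HB.lock Definition dir (R : realType) (V W : normedModType R) (f : V -> W)
  (x h : V) : W := 'd f x h.
Canonical dir_unlockable := Unlockable dir.unlock.

Section Dir.
Context {R : realType}.
Implicit Types (V W : normedModType R).

Lemma dirE V W (f : V -> W) x h : dir f x h = 'd f x h.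
Proof. by rewrite unlock. Qed.

Lemma dir_linear V W (f : V -> W) x : linear (dir f x).
Proof. by move=> a u v; rewrite !dirE linearP. Qed.

Lemma dir_near_eq V W (f g : V -> W) (x h : V) :
  (\forall z \near x, f z = g z) -> differentiable f x -> dir f x h = dir g x h.
Proof. by rewrite !dirE; exact: near_eq_diff. Qed.

Lemma dir_eq_on V W (A : set V) (f g : V -> W) (x h : V) :
  open A -> A x -> (forall z, A z -> f z = g z) ->
  smooth_on A f -> dir f x h = dir g x h.
Proof.
move=> oA Ax fg fA; apply: dir_near_eq; last exact: smooth_differentiable fA Ax.
by apply: (filterS fg); exact: open_nbhs_nbhs.
Qed.

Lemma dirD V W (f g : V -> W) (x h : V) :
  differentiable f x -> differentiable g x ->
  dir (fun z => f z + g z) x h = dir f x h + dir g x h.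
Proof. by rewrite !dirE; exact: diffDE. Qed.

Lemma dirB V W (f g : V -> W) (x h : V) :
  differentiable f x -> differentiable g x ->
  dir (fun z => f z - g z) x h = dir f x h - dir g x h.
Proof. by rewrite !dirE; exact: diffBE. Qed.

Lemma dirZ V W (k : R) (f : V -> W) (x h : V) : differentiable f x ->
  dir (fun z => k *: f z) x h = k *: dir f x h.
Proof. by move=> fd; rewrite !dirE (_ : (fun z => _) = k *: f)// diffZ. Qed.

Lemma dir_cst V W (c : W) (x h : V) : dir (fun=> c) x h = 0.
Proof. by rewrite dirE diff_cst. Qed.

Lemma dir_id V (x h : V) : dir id x h = h.
Proof. by rewrite dirE diff_idE. Qed.

Lemma dir_comp V (U : normedModType R) W (f : V -> U) (g : U -> W) (x h : V) :
  differentiable f x -> differentiable g (f x) ->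
  dir (fun z => g (f z)) x h = dir g (f x) (dir f x h).
Proof. by rewrite !dirE; exact: diff_compE. Qed.

Lemma dir_apply V W n (L : V -> 'rV[R]_n -> W) (X : V -> 'rV[R]_n) (x h : V) :
  (\forall z \near x, linear (L z)) ->
  (forall y, differentiable (L ^~ y) x) -> differentiable X x ->
  dir (fun z => L z (X z)) x h = dir (L ^~ (X x)) x h + L x (dir X x h).
Proof. by rewrite !dirE; exact: diff_applyE. Qed.

Lemma dir_schwarz V n (A : set V) (F : V -> 'rV[R]_n) (x h k : V) :
  open A -> A x -> smooth_on A F ->
  dir (fun z => dir F z h) x k = dir (fun z => dir F z k) x h.
Proof.
move=> oA Ax FA; rewrite unlock.
exact: schwarz oA Ax FA.
Qed.

Lemma dir_schwarz_scalar V (A : set V) (F : V -> R) (x h k : V) :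
  open A -> A x -> smooth_on A F ->
  dir (fun z => dir F z h) x k = dir (fun z => dir F z k) x h.
Proof.
by move=> oA Ax FA; rewrite unlock; exact: smooth_schwarz_scalar oA Ax FA.
Qed.

Lemma smooth_dir V W (A : set V) (f : V -> W) h :
  smooth_on A f -> smooth_on A (fun x => dir f x h).
Proof. by rewrite unlock; exact: smooth_diff. Qed.

Lemma smooth_cst V W (A : set V) (c : W) : smooth_on A (fun=> c).
Proof. by move=> r; exact: Ck_cst. Qed.

Lemma smoothD V W (A : set V) (f g : V -> W) : open A ->
  smooth_on A f -> smooth_on A g -> smooth_on A (fun x => f x + g x).
Proof. by move=> oA fA gA r; exact: CkD. Qed.

Lemma smoothB V W (A : set V) (f g : V -> W) : open A ->
  smooth_on A f -> smooth_on A g -> smooth_on A (fun x => f x - g x).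
Proof.
move=> oA fA gA.
rewrite (_ : (fun x => _) = fun x => f x + (-1) *: g x); last first.
  by apply/funext => x; rewrite scaleN1r.
apply: smoothD => // r; apply: Ck_scale => //; exact: Ck_cst.
Qed.

End Dir.

(** * Families of bilinear maps *)

Section BilinearFamily.
Context {R : realType} {V : normedModType R}.

(** The rule for a single linear argument, applied once to each argument of
    the bilinear maps. *)
Lemma dir_bilinear_family (W : normedModType R) d e l (O : set 'rV[R]_d)
   (B : 'rV[R]_d -> 'rV[R]_e -> 'rV[R]_l -> W)
   (f : V -> 'rV[R]_d) (X : V -> 'rV[R]_e) (Y : V -> 'rV[R]_l) (u h : V) :
  open O -> O (f u) ->
  (forall y b, O y -> linear (fun a => B y a b)) ->
  (forall y a, O y -> linear (fun b => B y a b)) ->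
  (forall a b, differentiable (fun y => B y a b) (f u)) ->
  differentiable f u -> differentiable X u -> differentiable Y u ->
  dir (fun z => B (f z) (X z) (Y z)) u h =
  dir (fun y => B y (X u) (Y u)) (f u) (dir f u h) +
  B (f u) (dir X u h) (Y u) + B (f u) (X u) (dir Y u h).
Proof.
rewrite !dirE.
move=> oO Of B1 B2 Bd fd Xd Yd.
have nearO : \forall z \near u, O (f z).
  by apply: (differentiable_continuous fd); exact: open_nbhs_nbhs.
have fB a b : differentiable (fun z => B (f z) a b) u.
  exact: (differentiable_comp fd (Bd a b)).
have XB b : is_diff u (fun z => B (f z) (X z) b)
    (fun h => 'd (fun z => B (f z) (X u) b) u h + B (f u) ('d X u h) b).
  apply: (is_diff_apply (L := fun z a => B (f z) a b)).
  - by apply: filterS nearO => z Oz; exact: B1.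
  - by move=> a; exact: fB.
  - exact: differentiableP.
rewrite (diff_applyE (L := fun z b => B (f z) (X z) b))//; last 1 first.
  by apply: filterS nearO => z Oz; exact: B2.
rewrite (is_diff_fun_eq _ (XB _)); congr (_ + _ + _).
exact: (diff_compE (g := fun y => B y (X u) (Y u))).
Qed.

Lemma smooth_bilinear_family (W : normedModType R) d e l (A : set V) (O : set 'rV[R]_d)
   (B : 'rV[R]_d -> 'rV[R]_e -> 'rV[R]_l -> W)
   (f : V -> 'rV[R]_d) (X : V -> 'rV[R]_e) (Y : V -> 'rV[R]_l) :
  open A -> open O -> (forall u, A u -> O (f u)) ->
  (forall y b, O y -> linear (fun a => B y a b)) ->
  (forall y a, O y -> linear (fun b => B y a b)) ->
  (forall a b, smooth_on O (fun y => B y a b)) ->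
  smooth_on A f -> smooth_on A X -> smooth_on A Y ->
  smooth_on A (fun z => B (f z) (X z) (Y z)).
Proof.
move=> oA oO fAO B1 B2 Bs fs Xs Ys.
apply: (smooth_apply (L := fun z b => B (f z) (X z) b)) => // [z Az|b].
  exact/B2/fAO.
apply: (smooth_apply (L := fun z a => B (f z) a b)) => // [z Az|a].
  exact/B1/fAO.
exact: (smooth_comp (g := fun y => B y a b) oA oO fAO).
Qed.

End BilinearFamily.

(** * Riemannian metrics in coordinates *)

(** The coordinate expression of a metric and of its Levi-Civita connection
    on an open set; the last field is metric compatibility, the symmetry of
    the Christoffel symbols is the absence of torsion. *)
Record coordinate_metric (R : realType) m (O : set 'rV[R]_m)
    (Gam : 'rV[R]_m -> 'rV[R]_m -> 'rV[R]_m -> 'rV[R]_m)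
    (G : 'rV[R]_m -> 'rV[R]_m -> 'rV[R]_m -> R) : Prop := {
  cm_open : open O;
  cm_christoffel_linl : forall u y, O u -> linear (fun x => Gam u x y);
  cm_christoffel_linr : forall u x, O u -> linear (fun y => Gam u x y);
  cm_christoffel_smooth : forall x y, smooth_on O (fun u => Gam u x y);
  cm_christoffel_sym : forall u x y, O u -> Gam u x y = Gam u y x;
  cm_linl : forall u y, O u -> linear (fun x => G u x y);
  cm_linr : forall u x, O u -> linear (fun y => G u x y);
  cm_smooth : forall x y, smooth_on O (fun u => G u x y);
  cm_sym : forall u x y, O u -> G u x y = G u y x;
  cm_compat : forall u h x y, O u ->
    dir (fun u => G u x y) u h = G u (Gam u h x) y + G u x (Gam u h y) }.

(** R(x, y) z for constant fields x, y, z; they commute, so that there is no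
    bracket term. *)
Definition coordinate_curvature (R : realType) m
    (Gam : 'rV[R]_m -> 'rV[R]_m -> 'rV[R]_m -> 'rV[R]_m) u x y z : 'rV[R]_m :=
  dir (fun q => Gam q y z) u x - dir (fun q => Gam q x z) u y
  + Gam u x (Gam u y z) - Gam u y (Gam u x z).

Section CoordinateCurvature.
Context {R : realType} {m : nat} {O : set 'rV[R]_m}.
Context {Gam : 'rV[R]_m -> 'rV[R]_m -> 'rV[R]_m -> 'rV[R]_m}.
Context {G : 'rV[R]_m -> 'rV[R]_m -> 'rV[R]_m -> R}.
Hypothesis GG : coordinate_metric O Gam G.
Let Rc := coordinate_curvature Gam.

Lemma coordinate_curvature_antisym u x y z : Rc u x y z = - Rc u y x z.
Proof.
by rewrite /Rc /coordinate_curvature; apply/rowP => i; rewrite !mxE; ring.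
Qed.

(** Without torsion, the derivatives and the quadratic terms cancel in pairs. *)
Lemma coordinate_bianchi u x y z : O u ->
  Rc u x y z + Rc u y z x + Rc u z x y = 0.
Proof.
move=> Ou; have sym := cm_christoffel_sym GG.
have dsym a b h : dir (fun q => Gam q a b) u h = dir (fun q => Gam q b a) u h.
  apply: dir_eq_on (cm_open GG) Ou _ (cm_christoffel_smooth GG a b) => q Oq.
  exact: sym.
rewrite /Rc /coordinate_curvature (sym u z y)// (sym u z x)// (sym u y x)//.
rewrite (dsym z y) (dsym z x) (dsym y x).
by apply/rowP => i; rewrite !mxE; ring.
Qed.

(** Metric compatibility, differentiated once more.  Its antisymmetrization in
    x and y is the skew-symmetry of the curvature. *)
Lemma coordinate_metric_diff2 u x y z w : O u ->
  dir (fun q => dir (fun q => G q z w) q y) u x =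
  G u (dir (fun q => Gam q y z) u x) w + G u (Gam u x (Gam u y z)) w
  + G u (Gam u y z) (Gam u x w)
  + G u (Gam u x z) (Gam u y w)
  + G u z (dir (fun q => Gam q y w) u x) + G u z (Gam u x (Gam u y w)).
Proof.
move=> Ou; have oO := cm_open GG.
have Gd a b : differentiable (fun q => G q a b) u.
  exact: smooth_differentiable (cm_smooth GG a b) Ou.
have GGam (X Y : 'rV[R]_m -> 'rV[R]_m) : smooth_on O X -> smooth_on O Y ->
    smooth_on O (fun q => G q (X q) (Y q)).
  move=> Xs Ys; apply: (smooth_bilinear_family (f := id) oO oO _ _ _ _ _ Xs Ys) => //.
  - exact: (cm_linl GG).
  - exact: (cm_linr GG).
  - exact: (cm_smooth GG).
  - exact: smooth_on_id.
have cs a : smooth_on O (fun=> a : 'rV[R]_m) by move=> r; exact: Ck_cst.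
have Gams := cm_christoffel_smooth GG.
have rule (X Y : 'rV[R]_m -> 'rV[R]_m) : smooth_on O X -> smooth_on O Y ->
    dir (fun q => G q (X q) (Y q)) u x =
    dir (fun q => G q (X u) (Y u)) u x + G u (dir X u x) (Y u) + G u (X u) (dir Y u x).
  move=> Xs Ys.
  rewrite (dir_bilinear_family (f := id) (O := O))//; first by rewrite dir_id.
  - exact: (cm_linl GG).
  - exact: (cm_linr GG).
  - exact: smooth_differentiable Xs Ou.
  - exact: smooth_differentiable Ys Ou.
transitivity (dir (fun q => G q (Gam q y z) w + G q z (Gam q y w)) u x).
  apply: dir_eq_on oO Ou _ (smooth_dir y (cm_smooth GG z w)) => q Oq.
  by rewrite (cm_compat GG).
rewrite dirD; first last.
- by apply: smooth_differentiable Ou; exact: GGam.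
- by apply: smooth_differentiable Ou; exact: GGam.
rewrite (rule (fun q => Gam q y z) (fun=> w))//.
rewrite (rule (fun=> z) (fun q => Gam q y w))// !dir_cst.
rewrite !(cm_compat GG)// (lin0 (cm_linl GG _ Ou)) (lin0 (cm_linr GG _ Ou)).
by ring.
Qed.

Lemma coordinate_curvature_skew u x y z w : O u ->
  G u (Rc u x y z) w = - G u (Rc u x y w) z.
Proof.
move=> Ou.
have := coordinate_metric_diff2 x y z w Ou.
have := coordinate_metric_diff2 y x z w Ou.
rewrite (dir_schwarz_scalar _ _ (cm_open GG) Ou (cm_smooth GG z w)) => ->.
have l1 := fun b => cm_linl GG b Ou.
rewrite /Rc /coordinate_curvature !(linB _ _ (l1 _)) !(linD _ _ (l1 _)) !(linN _ (l1 _)).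
rewrite !(cm_sym GG z)//.
lra.
Qed.

Lemma coordinate_curvature_pair u x y z w : O u ->
  G u (Rc u x y z) w = G u (Rc u z w x) y.
Proof.
move=> Ou.
apply: (curvature_pair_symmetry (T := fun x y z w => G u (Rc u x y z) w)).
- move=> a b c d; rewrite coordinate_curvature_antisym.
  by rewrite (linN _ (cm_linl GG d Ou)).
- by move=> a b c d; exact: coordinate_curvature_skew.
- move=> a b c d; rewrite -!(linD _ _ (cm_linl GG d Ou)).
  by rewrite coordinate_bianchi// (lin0 (cm_linl GG d Ou)).
Qed.

End CoordinateCurvature.

(** * The Gauss equation in coordinates *)

Section GaussEquation.
Context {R : realType} {n m : nat} {A : set 'rV[R]_n} {O : set 'rV[R]_m}.
Context {Gam : 'rV[R]_n -> 'rV[R]_n -> 'rV[R]_n -> 'rV[R]_n}.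
Context {G : 'rV[R]_n -> 'rV[R]_n -> 'rV[R]_n -> R}.
Context {Gamt : 'rV[R]_m -> 'rV[R]_m -> 'rV[R]_m -> 'rV[R]_m}.
Context {Gt : 'rV[R]_m -> 'rV[R]_m -> 'rV[R]_m -> R}.
Context {f : 'rV[R]_n -> 'rV[R]_m}.
Hypothesis GG : coordinate_metric A Gam G.
Hypothesis GGt : coordinate_metric O Gamt Gt.
Hypothesis fs : smooth_on A f.
Hypothesis fAO : forall u, A u -> O (f u).
Hypothesis isom : forall u x y, A u ->
  G u x y = Gt (f u) (dir f u x) (dir f u y).

Let oA := cm_open GG.
Let oO := cm_open GGt.

(** The covariant derivative along f of a vector field along f. *)
Definition cov_dir (X : 'rV[R]_n -> 'rV[R]_m) u h : 'rV[R]_m :=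
  dir X u h + Gamt (f u) (dir f u h) (X u).

Let dfs h : smooth_on A (fun u => dir f u h) := smooth_dir h fs.

Lemma smooth_christoffel_along (X Y : 'rV[R]_n -> 'rV[R]_m) :
  smooth_on A X -> smooth_on A Y ->
  smooth_on A (fun u => Gamt (f u) (X u) (Y u)).
Proof.
move=> Xs Ys; apply: (smooth_bilinear_family oA oO fAO _ _ _ fs Xs Ys).
- exact: (cm_christoffel_linl GGt).
- exact: (cm_christoffel_linr GGt).
- exact: (cm_christoffel_smooth GGt).
Qed.

Lemma smooth_cov_dir X h : smooth_on A X -> smooth_on A (fun u => cov_dir X u h).
Proof.
move=> Xs; apply: smoothD => //; first exact: smooth_dir.
exact: smooth_christoffel_along.
Qed.

Lemma cov_dir_metric X Y u h : A u -> smooth_on A X -> smooth_on A Y ->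
  dir (fun u => Gt (f u) (X u) (Y u)) u h =
  Gt (f u) (cov_dir X u h) (Y u) + Gt (f u) (X u) (cov_dir Y u h).
Proof.
move=> Au Xs Ys; have Of := fAO Au.
have fd := smooth_differentiable fs Au.
have Xd := smooth_differentiable Xs Au.
have Yd := smooth_differentiable Ys Au.
have Gd a b : differentiable (fun y => Gt y a b) (f u).
  exact: smooth_differentiable (cm_smooth GGt a b) Of.
rewrite (dir_bilinear_family h oO Of (cm_linl GGt) (cm_linr GGt) Gd fd Xd Yd).
rewrite (cm_compat GGt)// /cov_dir.
rewrite (linD _ _ (cm_linl GGt _ Of)) (linD _ _ (cm_linr GGt _ Of)).
by ring.
Qed.

Lemma cov_dirB X Y u h : A u -> smooth_on A X -> smooth_on A Y ->
  cov_dir (fun u => X u - Y u) u h = cov_dir X u h - cov_dir Y u h.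
Proof.
move=> Au Xs Ys; rewrite /cov_dir dirB; first last.
- exact: smooth_differentiable Ys Au.
- exact: smooth_differentiable Xs Au.
rewrite (linB _ _ (cm_christoffel_linr GGt _ (fAO Au))).
by apply/rowP => i; rewrite !mxE; ring.
Qed.

(** The second derivative of f is symmetric and the ambient connection has no
    torsion. *)
Lemma cov_dir_sym u h z : A u ->
  cov_dir (fun u => dir f u z) u h = cov_dir (fun u => dir f u h) u z.
Proof.
move=> Au; rewrite /cov_dir (dir_schwarz _ _ oA Au fs).
by rewrite (cm_christoffel_sym GGt)//; exact: fAO.
Qed.

(** The normal component of the covariant derivative, written without the
    orthogonal projection; [coordinate_second_form_normal] shows that it is
    normal. *)
Definition coordinate_second_form u h z : 'rV[R]_m :=
  cov_dir (fun u => dir f u z) u h - dir f u (Gam u h z).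
Local Notation II := coordinate_second_form.

(** <D_h (df z), df w> and <Gamma(h, z), w> satisfy the hypotheses of Koszul's
    argument: both are symmetric in h and z, and both symmetrize in z and w to
    the derivative of the induced metric. *)
Lemma coordinate_second_form_normal u h z w : A u ->
  Gt (f u) (II u h z) (dir f u w) = 0.
Proof.
move=> Au; have Of := fAO Au; rewrite /II (linB _ _ (cm_linl GGt _ Of)).
apply/eqP; rewrite subr_eq0 -isom//; apply/eqP; move: h z w.
apply: koszul_unique => h z w; first by rewrite cov_dir_sym.
  by rewrite (cm_christoffel_sym GG).
rewrite [in X in _ + X](cm_sym GGt)// [in X in _ = _ + X](cm_sym GG)//.
rewrite -(cov_dir_metric (X := fun u => dir f u z) (Y := fun u => dir f u w))//.
rewrite -(cm_compat GG)//; apply/esym.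
by apply: dir_eq_on oA Au _ (cm_smooth GG z w) => q Aq; rewrite isom.
Qed.

Lemma dir_smooth_field (Y : 'rV[R]_n -> 'rV[R]_n) u h : A u -> smooth_on A Y ->
  dir (fun u => dir f u (Y u)) u h =
  dir (fun v => dir f v (Y u)) u h + dir f u (dir Y u h).
Proof.
move=> Au Ys; rewrite (dir_apply (L := fun u => dir f u))//.
- have nA : nbhs u A := open_nbhs_nbhs (conj oA Au).
  by apply: filterS nA => v _; exact: dir_linear.
- by move=> y; exact: smooth_differentiable (dfs y) Au.
- exact: smooth_differentiable Ys Au.
Qed.

Lemma smooth_pushforward (Y : 'rV[R]_n -> 'rV[R]_n) : smooth_on A Y ->
  smooth_on A (fun u => dir f u (Y u)).
Proof.
move=> Ys; apply: (smooth_apply (L := fun u => dir f u)) => // z _.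
exact: dir_linear.
Qed.

(** The product rule together with the definition of II. *)
Lemma gauss_formula (Y : 'rV[R]_n -> 'rV[R]_n) u h : A u -> smooth_on A Y ->
  cov_dir (fun u => dir f u (Y u)) u h =
  II u h (Y u) + dir f u (Gam u h (Y u) + dir Y u h).
Proof.
move=> Au Ys; rewrite /II /cov_dir dir_smooth_field//.
rewrite (linD _ _ (dir_linear f u)).
by apply/rowP => i; rewrite !mxE; ring.
Qed.

Lemma smooth_second_form h z : smooth_on A (fun u => II u h z).
Proof.
apply: smoothB => //; first exact: smooth_cov_dir.
by apply: smooth_pushforward; exact: (cm_christoffel_smooth GG).
Qed.

(** The third derivatives of f cancel by Schwarz's theorem applied to df z, the
    terms with a second derivative of f by Schwarz's theorem applied to f, and
    the mixed terms in pairs. *)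
Lemma cov_dir_commutator z u k h : A u ->
  cov_dir (fun u => cov_dir (fun u => dir f u z) u h) u k -
  cov_dir (fun u => cov_dir (fun u => dir f u z) u k) u h =
  coordinate_curvature Gamt (f u) (dir f u k) (dir f u h) (dir f u z).
Proof.
move=> Au; have Of := fAO Au.
have fd := smooth_differentiable fs Au.
have cov2 a b : cov_dir (fun u => cov_dir (fun u => dir f u z) u b) u a =
   dir (fun u => dir (fun u => dir f u z) u b) u a
   + (dir (fun y => Gamt y (dir f u b) (dir f u z)) (f u) (dir f u a)
      + Gamt (f u) (dir (fun u => dir f u b) u a) (dir f u z)
      + Gamt (f u) (dir f u b) (dir (fun u => dir f u z) u a))
   + (Gamt (f u) (dir f u a) (dir (fun u => dir f u z) u b)
      + Gamt (f u) (dir f u a) (Gamt (f u) (dir f u b) (dir f u z))).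
  rewrite {1}/cov_dir dirD; first last.
  - apply: smooth_differentiable Au; exact: smooth_christoffel_along.
  - apply: smooth_differentiable Au; exact/smooth_dir.
  rewrite /cov_dir (linD _ _ (cm_christoffel_linr GGt _ Of)).
  congr (_ + _ + _).
  apply: (dir_bilinear_family (X := fun u => dir f u b) (Y := fun u => dir f u z)
    a oO Of (cm_christoffel_linl GGt) (cm_christoffel_linr GGt)) => //.
  - by move=> c d; exact: smooth_differentiable (cm_christoffel_smooth GGt c d) Of.
  - exact: smooth_differentiable (dfs b) Au.
  - exact: smooth_differentiable (dfs z) Au.
rewrite !cov2 (dir_schwarz k h oA Au (dfs z)) (dir_schwarz k h oA Au fs).
rewrite /coordinate_curvature.
by apply/rowP => i; rewrite !mxE; ring.
Qed.

(** This is the derivative of <II(h, z), df w> = 0: only the normal part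
    II(k, w) of D_k (df w) meets the normal vector II(h, z). *)
Lemma cov_dir_second_form u k h z w : A u ->
  Gt (f u) (cov_dir (fun u => II u h z) u k) (dir f u w) =
  - Gt (f u) (II u h z) (II u k w).
Proof.
move=> Au; have Of := fAO Au.
have := cov_dir_metric k Au (smooth_second_form h z) (dfs w).
rewrite -(dir_eq_on (f := fun=> 0) _ oA Au); last 2 first.
- by move=> q Aq; rewrite coordinate_second_form_normal.
- exact: smooth_cst.
rewrite dir_cst.
have -> : cov_dir (fun u => dir f u w) u k = II u k w + dir f u (Gam u k w).
  by rewrite subrK.
rewrite (linD _ _ (cm_linr GGt _ Of)) coordinate_second_form_normal// addr0.
by move=> /esym/eqP; rewrite addr_eq0 => /eqP.
Qed.

(** Decompose D_h (df z) = II(h, z) + df (Gamma(h, z)), differentiate it along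
    k, antisymmetrize in h and k, and pair with df w. *)
Theorem coordinate_gauss_equation u k h z w : A u ->
  Gt (f u) (coordinate_curvature Gamt (f u) (dir f u k) (dir f u h) (dir f u z))
     (dir f u w) =
  G u (coordinate_curvature Gam u k h z) w
  + Gt (f u) (II u k z) (II u h w) - Gt (f u) (II u h z) (II u k w).
Proof.
move=> Au; have Of := fAO Au.
have covII a b : cov_dir (fun u => cov_dir (fun u => dir f u z) u b) u a =
    cov_dir (fun u => II u b z) u a + (II u a (Gam u b z)
    + dir f u (Gam u a (Gam u b z) + dir (fun u => Gam u b z) u a)).
  rewrite -gauss_formula//; last exact: (cm_christoffel_smooth GG).
  rewrite [X in _ = X + _]cov_dirB//; first by rewrite subrK.
  - exact: smooth_cov_dir.
  - by apply: smooth_pushforward; exact: (cm_christoffel_smooth GG).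
rewrite -cov_dir_commutator// !covII.
have l := cm_linl GGt (dir f u w) Of.
have lD a b c : Gt (f u) (a + (b + c)) (dir f u w) =
    Gt (f u) a (dir f u w) + (Gt (f u) b (dir f u w) + Gt (f u) c (dir f u w)).
  by rewrite !(linD _ _ l).
rewrite (linB _ _ l) 2!lD !cov_dir_second_form//.
rewrite !coordinate_second_form_normal// -!isom//.
have l' := cm_linl GG w Au.
rewrite /coordinate_curvature !(linB _ _ l') !(linD _ _ l') !(linN _ l').
by ring.
Qed.

End GaussEquation.

(** * Change of charts *)

Section Charts.
Context {R : realType} {m : nat} {M : manifold R m}.
Implicit Types (p q r a : M) (x y z : 'rV[R]_m) (X Y Z : M -> 'rV[R]_m).

Lemma srcp p : src p p. Proof. exact: chart_at_source. Qed.

Lemma src_open p : open (src p). Proof. exact: source_open. Qed.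

Lemma crdK p q : src p q -> prm p (crd p q) = q.
Proof. exact: coordK. Qed.

(** Rewritten as a preimage under the inverse chart, the image of an open set
    is seen to be open. *)
Lemma crd_image_eq p (U : set M) :
  crd p @` (U `&` src p) = (crd p @` src p) `&` prm p @^-1` U.
Proof.
apply/seteqP; split=> u.
  by move=> [q [Uq pq] <-]; split; [exists q | rewrite /= crdK].
by move=> [[q pq <-]] /=; rewrite crdK// => Uq; exists q.
Qed.

Lemma open_crd_image p (U : set M) : open U -> open (crd p @` (U `&` src p)).
Proof.
move=> oU; rewrite crd_image_eq openE => u [pu Uu].
have n1 : nbhs u (crd p @` src p).
  by apply: open_nbhs_nbhs; split=> //; exact: target_open.
have n2 : nbhs u (prm p @^-1` U).
  by apply: (param_continuous pu); exact: open_nbhs_nbhs.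
exact: filterI.
Qed.

Lemma transition_smooth p q :
  smooth_on (crd p @` (src p `&` src q)) (fun u => crd q (prm p u)).
Proof. exact: chart_at_compatible. Qed.

Lemma transition_differentiable p q a : src p a -> src q a ->
  differentiable (fun u => crd q (prm p u)) (crd p a).
Proof.
by move=> pa qa; apply: smooth_differentiable (@transition_smooth p q) _; exists a.
Qed.

Lemma near_crd p a (U : set M) : open U -> src p a -> U a ->
  \forall u \near crd p a, U (prm p u) /\ src p (prm p u).
Proof.
move=> oU pa Ua.
have n : nbhs (crd p a) (crd p @` (U `&` src p)).
  by apply: open_nbhs_nbhs; split; [exact: open_crd_image | exists a].
by apply: filterS n => u [q [Uq pq] <-]; rewrite crdK.
Qed.

Lemma differentiable_change_chart (W : normedModType R) (F : M -> W) p q a :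
  src p a -> src q a -> differentiable (fun u => F (prm q u)) (crd q a) ->
  differentiable (fun u => F (prm p u)) (crd p a).
Proof.
move=> pa qa Fd.
apply: (near_eq_differentiable
  (f := (fun u => F (prm q u)) \o (fun u => crd q (prm p u)))).
  have := near_crd (src_open q) pa qa; apply: filterS => u [qu _] /=.
  by rewrite crdK.
apply: differentiable_comp; first exact: transition_differentiable.
by rewrite crdK.
Qed.

(** The chain rule through a transition map.  It is also the cocycle rule for
    tangent vectors, when F is itself a coordinate map. *)
Lemma dir_change_chart (W : normedModType R) (F : M -> W) p q a x :
  src p a -> src q a -> differentiable (fun u => F (prm q u)) (crd q a) ->
  dir (fun u => F (prm p u)) (crd p a) x =
  dir (fun u => F (prm q u)) (crd q a)
      (dir (fun u => crd q (prm p u)) (crd p a) x).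
Proof.
move=> pa qa Fd.
transitivity (dir (fun u => F (prm q (crd q (prm p u)))) (crd p a) x).
  apply: dir_near_eq; last exact: differentiable_change_chart Fd.
  have := near_crd (src_open q) pa qa; apply: filterS => u [qu _] /=.
  by rewrite crdK.
rewrite (dir_comp (f := fun u => crd q (prm p u)) (g := fun u => F (prm q u))).
- by rewrite crdK.
- exact: transition_differentiable.
- by rewrite crdK.
Qed.

Lemma dir_transition_self p a x : src p a ->
  dir (fun u => crd p (prm p u)) (crd p a) x = x.
Proof.
move=> pa; rewrite -[RHS](dir_id (crd p a)).
apply: dir_near_eq; last exact: transition_differentiable.
have n : nbhs (crd p a) (crd p @` src p).
  by apply: open_nbhs_nbhs; split; [exact: target_open | exists a].
by apply: filterS n => u [q pq <-]; rewrite crdK.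
Qed.

Lemma componentsE p q x :
  components p q x = dir (fun u => crd p (prm q u)) (crd q q) x.
Proof. by rewrite dirE. Qed.

Lemma const_fieldE p q x :
  const_field p x q = dir (fun u => crd q (prm p u)) (crd p q) x.
Proof. by rewrite dirE. Qed.

Lemma components_linear p q : linear (components p q).
Proof. by move=> k u v; rewrite /components linearP. Qed.

Lemma const_field_linear p q : linear ((const_field p)^~ q).
Proof. by move=> k u v; rewrite /const_field linearP. Qed.

Lemma const_fieldK p q x : src p q -> components p q (const_field p x q) = x.
Proof.
move=> pq; rewrite componentsE const_fieldE.
rewrite -(dir_change_chart (F := crd p)); first exact: dir_transition_self.
- by [].
- exact: srcp.
- by apply: transition_differentiable => //; exact: srcp.
Qed.

Lemma componentsK p q x : src p q -> const_field p (components p q x) q = x.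
Proof.
move=> pq; rewrite componentsE const_fieldE.
rewrite -(dir_change_chart (F := crd q)); first exact/dir_transition_self/srcp.
- exact: srcp.
- by [].
- by apply: transition_differentiable => //; exact: srcp.
Qed.

Lemma components_self p x : components p p x = x.
Proof. by rewrite componentsE dir_transition_self//; exact: srcp. Qed.

Lemma const_field_self p x : const_field p x p = x.
Proof. by rewrite const_fieldE dir_transition_self//; exact: srcp. Qed.

Lemma local_rep_crd p q Y : src p q -> local_rep p Y (crd p q) = components p q (Y q).
Proof. by move=> pq; rewrite /local_rep crdK. Qed.

Lemma local_rep_change_chart p r q Y : src p q -> src r q ->
  local_rep r Y (crd r q) =
  dir (fun u => crd r (prm p u)) (crd p q) (local_rep p Y (crd p q)).
Proof.
move=> pq rq; rewrite !local_rep_crd// !componentsE.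
rewrite -(dir_change_chart (F := crd r))//; first exact: srcp.
exact: transition_differentiable.
Qed.

(** On a set covered by one chart, smoothness can be tested in that chart. *)
Lemma smooth_fun_chart p (U : set M) (F : M -> R) : open U -> U `<=` src p ->
  smooth_on (crd p @` U) (fun u => F (prm p u)) -> smooth_fun_on U F.
Proof.
move=> oU Up Fs r; have oUr := open_crd_image (p := r) oU.
have oUp : open (crd p @` U).
  by rewrite -(setIidl Up); exact: open_crd_image.
apply: (smooth_ext (f := (fun u => F (prm p u)) \o (fun u => crd p (prm r u)))) => //.
  by move=> u [q [Uq rq] <-] /=; rewrite (crdK rq) crdK//; exact: Up.
apply: (smooth_comp oUr oUp) Fs.
  by move=> u [q [Uq rq] <-]; rewrite crdK//; exists q.
apply: smooth_sub (@transition_smooth r p) => u [q [Uq rq] <-].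
by exists q => //; split=> //; exact: Up.
Qed.

Lemma smooth_field_chart p (U : set M) Y : open U -> U `<=` src p ->
  smooth_on (crd p @` U) (local_rep p Y) -> smooth_field_on U Y.
Proof.
move=> oU Up Ys r; have oUr := open_crd_image (p := r) oU.
have oUp : open (crd p @` U).
  by rewrite -(setIidl Up); exact: open_crd_image.
have trs : smooth_on (crd r @` (U `&` src r)) (fun u => crd p (prm r u)).
  apply: smooth_sub (@transition_smooth r p) => u [q [Uq rq] <-].
  by exists q => //; split=> //; exact: Up.
have trU u : (crd r @` (U `&` src r)) u -> (crd p @` U) (crd p (prm r u)).
  by move=> [q [Uq rq] <-]; rewrite crdK//; exists q.
apply: (smooth_ext (f := fun u => dir (fun v => crd r (prm p v))
   (crd p (prm r u)) (local_rep p Y (crd p (prm r u))))) => //.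
  move=> u [q [Uq rq] <-]; by rewrite (crdK rq) (local_rep_change_chart _ (Up _ Uq) rq).
apply: (smooth_apply (L := fun u => dir (fun v => crd r (prm p v)) (crd p (prm r u)))
  (X := fun u => local_rep p Y (crd p (prm r u)))) => //.
- by move=> z _; exact: dir_linear.
- move=> y.
  apply: (smooth_comp (B := crd p @` (src p `&` src r))
    (g := fun v => dir (fun v => crd r (prm p v)) v y) oUr _ _ trs).
  + by rewrite setIC; apply: open_crd_image; exact: src_open.
  + by move=> u [q [Uq rq] <-]; rewrite crdK//; exists q => //; split=> //; exact: Up.
  + by apply: smooth_dir; exact: transition_smooth.
- exact: (smooth_comp oUr oUp trU trs Ys).
Qed.

Lemma smooth_const_field p x : smooth_field_on (src p) (const_field p x).
Proof.
apply: (@smooth_field_chart p) => //; first exact: src_open.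
have op : open (crd p @` src p) by exact: target_open.
apply: (smooth_ext (f := fun=> x)) => //; last exact: smooth_cst.
by move=> u [q pq <-]; rewrite local_rep_crd// const_fieldK.
Qed.

Lemma smooth_near_const_field p q x : src p q -> smooth_field_near q (const_field p x).
Proof.
move=> pq; exists (src p); last exact: smooth_const_field.
by split=> //; exact: src_open.
Qed.

Lemma smooth_field_nearP p Y :
  smooth_field_near p Y <-> exists U, [/\ open U, U p, U `<=` src p &
    smooth_on (crd p @` U) (local_rep p Y)].
Proof.
split=> [[U [oU Up] Ys]|[U [oU Up Us Ys]]]; last first.
  exists U; first by split.
  exact: (@smooth_field_chart p).
exists (U `&` src p); split=> //.
- by apply: openI => //; exact: src_open.
- by split=> //; exact: srcp.
Qed.

Lemma smooth_field_nearD p Y Z : smooth_field_near p Y -> smooth_field_near p Z ->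
  smooth_field_near p (Y \+ Z).
Proof.
move=> [U [oU Up] Ys] [U' [oU' U'p] Zs]; apply/smooth_field_nearP.
have oUU : open (U `&` U' `&` src p).
  by apply: openI; [exact: openI | exact: src_open].
exists (U `&` U' `&` src p); split=> //; first by split=> //; exact: srcp.
have op : open (crd p @` (U `&` U' `&` src p)).
  by apply: open_crd_image; exact: openI.
apply: (smooth_ext (f := fun u => local_rep p Y u + local_rep p Z u)) => //.
  by move=> u _; rewrite /local_rep (linD _ _ (@components_linear _ _)).
apply: smoothD => //.
- by apply: smooth_sub (Ys p) => u [q [[Uq _] pq] <-]; exists q.
- by apply: smooth_sub (Zs p) => u [q [[_ Uq] pq] <-]; exists q.
Qed.

Lemma smooth_field_near_scale p (F : M -> R) Y :
  smooth_fun_near p F -> smooth_field_near p Y ->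
  smooth_field_near p (fun q => F q *: Y q).
Proof.
move=> [U [oU Up] Ys] [U' [oU' U'p] Zs]; apply/smooth_field_nearP.
have oUU : open (U `&` U' `&` src p).
  by apply: openI; [exact: openI | exact: src_open].
exists (U `&` U' `&` src p); split=> //; first by split=> //; exact: srcp.
have op : open (crd p @` (U `&` U' `&` src p)).
  by apply: open_crd_image; exact: openI.
apply: (smooth_ext (f := fun u => F (prm p u) *: local_rep p Y u)) => //.
  by move=> u _; rewrite /local_rep (linZ _ _ (@components_linear _ _)).
move=> k; apply: Ck_scale => //.
- by apply: Ck_sub (Ys p k) => u [q [[Uq _] pq] <-]; exists q.
- by apply: Ck_sub (Zs p k) => u [q [[_ Uq] pq] <-]; exists q.
Qed.

Lemma smooth_field_near_sum p k (Y : 'I_k -> M -> 'rV[R]_m) :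
  (forall i, smooth_field_near p (Y i)) ->
  smooth_field_near p (fun q => \sum_i Y i q).
Proof.
move=> Ys.
rewrite (_ : (fun q => _) = \sum_i Y i); last by apply/funext => q; rewrite fct_sumE.
apply: (big_ind (smooth_field_near p)) => //.
- apply/smooth_field_nearP; exists (src p); split=> //.
  + exact: src_open.
  + exact: srcp.
  + rewrite (_ : local_rep p 0 = fun=> 0); first exact: smooth_cst.
    by apply/funext => u; rewrite /local_rep (lin0 (@components_linear _ _)).
- by move=> *; exact: smooth_field_nearD.
Qed.

(** In the chart at q, the field with constant components y in the chart at p
    is the derivative along y of the transition map, composed with the inverse
    transition map. *)
Lemma dir_local_rep_const_field p q y h : src p q ->
  dir (local_rep q (const_field p y)) (crd q q) h =
  dir (fun v => dir (fun v => crd q (prm p v)) v y) (crd p q) (components p q h).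
Proof.
move=> pq; have qq := srcp q; rewrite componentsE.
have sd : differentiable (fun v => dir (fun v => crd q (prm p v)) v y) (crd p q).
  apply: (smooth_differentiable (smooth_dir y (@transition_smooth p q))).
  by exists q.
transitivity (dir (fun u => dir (fun v => crd q (prm p v)) (crd p (prm q u)) y)
  (crd q q) h); last first.
  rewrite (dir_comp (f := fun u => crd p (prm q u))
    (g := fun u => dir (fun v => crd q (prm p v)) u y)).
  - by rewrite crdK.
  - exact: transition_differentiable.
  - by rewrite crdK.
apply: dir_near_eq.
  have := near_crd (src_open p) qq pq; apply: filterS => u [pu qu].
  rewrite /local_rep componentsE const_fieldE -(dir_change_chart (F := crd q))//.
  - exact: srcp.
  - by apply: transition_differentiable => //; exact: srcp.
apply: smooth_differentiable (@smooth_const_field p y q) _.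
by exists q.
Qed.

Lemma lie_bracketE X Y p : lie_bracket X Y p =
  dir (local_rep p Y) (crd p p) (X p) - dir (local_rep p X) (crd p p) (Y p).
Proof. by rewrite unlock. Qed.

(** The bracket is the antisymmetrized second derivative of a transition map. *)
Lemma lie_bracket_const_field p q x y : src p q ->
  lie_bracket (const_field p x) (const_field p y) q = 0.
Proof.
move=> pq; rewrite lie_bracketE !dir_local_rep_const_field// !const_fieldK//.
have op : open (crd p @` (src p `&` src q)).
  by rewrite setIC; apply: open_crd_image; exact: src_open.
rewrite (dir_schwarz _ _ op _ (@transition_smooth p q)) ?subrr//.
by exists q => //; split=> //; exact: srcp.
Qed.

End Charts.

(** * Connections in charts *)

Section ConnectionInCoordinates.
Context {R : realType} {m : nat} {M : manifold R m}.
Variables (nabla : connection M) (nablaP : is_connection nabla).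
Implicit Types (p q r : M) (x y z : 'rV[R]_m) (X Y Z : M -> 'rV[R]_m).

Lemma dfunE (F : M -> R) p x : dfun F p x = dir (fun u => F (prm p u)) (crd p p) x.
Proof. by rewrite dirE. Qed.

Lemma dfun_near_cst p (F : M -> R) (U : set M) c x :
  open_nbhs p U -> (forall q, U q -> F q = c) -> dfun F p x = 0.
Proof.
move=> [oU Up] Fc; rewrite dfunE -[RHS](dir_cst c (crd p p) x).
apply/esym/dir_near_eq; last exact: differentiable_cst.
have := near_crd oU (srcp p) Up; apply: filterS => u [Uu _].
by rewrite Fc.
Qed.

Lemma smooth_fun_near_cst p (F : M -> R) (U : set M) c :
  open_nbhs p U -> (forall q, U q -> F q = c) -> smooth_fun_near p F.
Proof.
move=> [oU Up] Fc; exists U => // r.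
apply: (smooth_ext (f := fun=> c)); first exact: open_crd_image.
  by move=> u [q [Uq rq] <-] /=; rewrite crdK// Fc.
exact: smooth_cst.
Qed.

(** The indicator function F of U is constant near p, hence smooth near p with
    derivative 0, and the Leibniz rule gives that F Y and Y have the same
    covariant derivative at p.  But F Y = F Z everywhere. *)
Lemma connection_local p x Y Z (U : set M) : open_nbhs p U ->
  (forall q, U q -> Y q = Z q) -> smooth_field_near p Y -> smooth_field_near p Z ->
  nabla p x Y = nabla p x Z.
Proof.
move=> pU YZ Ys Zs; pose F q : R := if `[< U q >] then 1 else 0.
have F1 q : U q -> F q = 1 by rewrite /F => Uq; case: asboolP.
have restrict W : smooth_field_near p W ->
    nabla p x W = nabla p x (fun q => F q *: W q).
  move=> Ws; rewrite (connection_leibniz nablaP)//; last exact: smooth_fun_near_cst F1.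
  rewrite (dfun_near_cst _ pU F1) F1 ?scale0r ?scale1r ?add0r//.
  by case: pU.
rewrite (restrict Y)// (restrict Z)//; congr (nabla _ _ _).
by apply/funext => q; rewrite /F; case: asboolP => [/YZ ->//|_]; rewrite !scale0r.
Qed.

Lemma connection_lin p Y : smooth_field_near p Y ->
  linear (fun x => nabla p x Y).
Proof. by move=> Ys k x y; rewrite (connection_linear nablaP). Qed.

Lemma connection_scale p x k Y : smooth_field_near p Y ->
  nabla p x (fun q => k *: Y q) = k *: nabla p x Y.
Proof.
move=> Ys; have pT : open_nbhs p setT by split=> //; exact: openT.
rewrite (connection_leibniz nablaP x (f := fun=> k))//; last first.
  exact: smooth_fun_near_cst pT _.
by rewrite (dfun_near_cst x pT (fun _ _ => erefl k)) scale0r add0r.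
Qed.

Lemma connection_sum p x k (Y : 'I_k -> M -> 'rV[R]_m) :
  (forall i, smooth_field_near p (Y i)) ->
  nabla p x (fun q => \sum_i Y i q) = \sum_i nabla p x (Y i).
Proof.
elim: k Y => [|k IH] Y Ys.
  rewrite big_ord0 (_ : (fun q => _) = fun q => 0 *: (0 : M -> 'rV[R]_m) q).
    rewrite connection_scale ?scale0r//.
    have := @smooth_field_near_sum _ _ M p 0 (fun _ => 0).
    rewrite (_ : (fun q => _) = 0); first by apply; case.
    by apply/funext => q; rewrite big_ord0.
  by apply/funext => q; rewrite big_ord0 scale0r.
rewrite big_ord_recr /= -IH//.
rewrite -(connectionD nablaP)//; last exact: smooth_field_near_sum.
by congr (nabla _ _ _); apply/funext => q /=; rewrite big_ord_recr.
Qed.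

Lemma connection_const_field_linear p q x : src p q ->
  linear (fun y => nabla q x (const_field p y)).
Proof.
move=> pq k y z.
have cs w := smooth_near_const_field w pq.
rewrite -connection_scale// -(connectionD nablaP)//; last first.
  apply: smooth_field_near_scale => //.
  by apply: (@smooth_fun_near_cst q _ setT k) => //; split=> //; exact: openT.
by congr (nabla _ _ _); apply/funext => r; exact: const_field_linear.
Qed.

(** The Christoffel symbols in the chart at p, as a bilinear map depending on
    the point u of the chart. *)
Definition christoffel p u x y : 'rV[R]_m :=
  local_rep p (fun q => nabla q (const_field p x q) (const_field p y)) u.

Lemma christoffelE p q x y : src p q -> christoffel p (crd p q) x y =
  components p q (nabla q (const_field p x q) (const_field p y)).
Proof. by move=> pq; rewrite /christoffel local_rep_crd. Qed.

Lemma christoffel_self p x y :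
  christoffel p (crd p p) x y = nabla p x (const_field p y).
Proof. by rewrite christoffelE ?components_self ?const_field_self//; exact: srcp. Qed.

Lemma smooth_nabla_const_field p x y : smooth_field_on (src p)
  (fun q => nabla q (const_field p x q) (const_field p y)).
Proof.
by apply: (connection_smooth nablaP); [exact: src_open|exact: smooth_const_field..].
Qed.

Lemma christoffel_smooth p x y :
  smooth_on (crd p @` src p) (fun u => christoffel p u x y).
Proof.
have := @smooth_nabla_const_field p x y p; rewrite setIid; exact.
Qed.

Lemma christoffel_linl p u y : (crd p @` src p) u ->
  linear (fun x => christoffel p u x y).
Proof.
move=> [q pq <-] k x z; rewrite !christoffelE//.
rewrite const_field_linear connection_lin; first exact: components_linear.
exact: smooth_near_const_field.
Qed.

Lemma christoffel_linr p u x : (crd p @` src p) u ->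
  linear (fun y => christoffel p u x y).
Proof.
move=> [q pq <-] k y z; rewrite !christoffelE//.
rewrite connection_const_field_linear//; exact: components_linear.
Qed.

(** Near p, Y is the combination of coordinate fields whose coefficients are
    its components; additivity and the Leibniz rule apply to it, and locality
    allows the replacement. *)
Lemma connection_in_chart p x Y : smooth_field_near p Y ->
  nabla p x Y = dir (local_rep p Y) (crd p p) x + christoffel p (crd p p) x (Y p).
Proof.
move=> /smooth_field_nearP[U [oU Up Us Ys]]; have pp := srcp p.
have oUp : open (crd p @` U) by rewrite -(setIidl Us); exact: open_crd_image.
have Upp : (crd p @` U) (crd p p) by exists p.
pose c a q := components p q (Y q) 0 a.
pose e a := const_field p (delta_mx 0 a).
have cs a : smooth_fun_near p (c a).
  exists U => //; apply: (smooth_fun_chart (p := p)) => // k.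
  exact: Ck_coord (Ys k).
have es a : smooth_field_near p (e a) by exact: smooth_near_const_field.
rewrite (@connection_local p x Y (fun q => \sum_a c a q *: e a q) U); first last.
- by apply: smooth_field_near_sum => a; exact: smooth_field_near_scale.
- by apply/smooth_field_nearP; exists U.
- move=> q Uq; rewrite -[LHS](componentsK _ (Us _ Uq)).
  by rewrite [LHS](linear_row_sum _ (@const_field_linear _ _ _ _ _)).
- by [].
rewrite connection_sum; last by move=> a; exact: smooth_field_near_scale.
rewrite [in RHS](linear_row_sum (Y p) (@christoffel_linr _ _ _ _)); last by exists p.
rewrite [X in _ = X + _]row_sum_delta -big_split; apply: eq_bigr => a _.
rewrite (connection_leibniz nablaP)// christoffel_self /c components_self.
congr (_ + _); rewrite /e const_field_self; congr (_ *: _).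
rewrite dfunE !dirE.
apply: (diff_coordE _ a).
exact: smooth_differentiable Ys Upp.
Qed.

(** The bracket term vanishes since coordinate fields commute. *)
Lemma curvature_in_chart p x y z :
  Rm_op nabla p x y z = coordinate_curvature (christoffel p) (crd p p) x y z.
Proof.
have ns a b : smooth_field_near p (fun q => nabla q (const_field p a q) (const_field p b)).
  exists (src p); last exact: smooth_nabla_const_field.
  by split; [exact: src_open | exact: srcp].
rewrite /Rm_op /curvature lie_bracket_const_field; last exact: srcp.
rewrite (lin0 (connection_lin (smooth_near_const_field z (srcp p)))) subr0.
have e a b c : nabla p a (fun q => nabla q (const_field p b q) (const_field p c)) =
    dir (fun u => christoffel p u b c) (crd p p) a
    + christoffel p (crd p p) a (christoffel p (crd p p) b c).
  by rewrite connection_in_chart// const_field_self -christoffel_self.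
rewrite !const_field_self !e /coordinate_curvature opprD addrA.
by congr (_ - _); rewrite -!addrA; congr (_ + _); rewrite addrC.
Qed.

End ConnectionInCoordinates.

(** * Metrics in charts *)

Section MetricInCoordinates.
Context {R : realType} {m : nat} {M : manifold R m}.
Variables (g : riemannian_metric M).
Implicit Types (p q r : M) (x y z : 'rV[R]_m) (X Y Z : M -> 'rV[R]_m).

Lemma inner_linl p y : linear (fun x => inner g p x y : R).
Proof. by move=> k u v; rewrite /inner !mulmxDl -!scalemxAl mxE [X in X + _]mxE. Qed.

Lemma inner_linr p x : linear (fun y => inner g p x y : R).
Proof.
by move=> k u v; rewrite /inner linearP mulmxDr -scalemxAr mxE [X in X + _]mxE.
Qed.

Lemma inner_sym p x y : inner g p x y = inner g p y x.
Proof.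
rewrite /inner -[in RHS](gram_sym g p) -[in RHS](trmxK y) -!trmx_mul mulmxA !mxE.
by apply: eq_bigr => i _.
Qed.

Lemma inner_eq0 p x : (forall y, inner g p x y = 0) -> x = 0.
Proof.
move=> x0; apply/eqP; apply: contraT => /(gram_posdef g p).
by rewrite -[ltRHS]/(inner g p x x) x0 ltxx.
Qed.

Lemma inner_ext p x y : (forall z, inner g p x z = inner g p y z) -> x = y.
Proof.
move=> xy; apply: subr0_eq; apply: (@inner_eq0 p) => z.
by rewrite (linB _ _ (inner_linl p z)) /= xy subrr.
Qed.

(** A vector of the kernel is orthogonal to all vectors, hence 0 since the
    metric is definite. *)
Lemma gram_unit p : gram g p \in unitmx.
Proof.
rewrite -row_free_unit; apply/inj_row_free => v v0.
by apply: (@inner_eq0 p) => y; rewrite /inner v0 mul0mx mxE.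
Qed.

Lemma inner_sharp p (alpha : 'rV[R]_m -> R) y : linear alpha ->
  inner g p (sharp g p alpha) y = alpha y.
Proof.
move=> al; rewrite /inner /sharp mulmxKV ?gram_unit// mxE.
rewrite (linear_row_sum y al); apply: eq_bigr => i _.
by rewrite !mxE mulrC.
Qed.

Definition coordinate_inner p u x y : R :=
  inner g (prm p u) (const_field p x (prm p u)) (const_field p y (prm p u)).

Lemma coordinate_inner_self p x y :
  coordinate_inner p (crd p p) x y = inner g p x y.
Proof. by rewrite /coordinate_inner (crdK (srcp p)) !const_field_self. Qed.

Lemma coordinate_inner_smooth p x y :
  smooth_on (crd p @` src p) (fun u => coordinate_inner p u x y).
Proof. by have := @gram_smooth _ _ _ g p x y p; rewrite setIid; exact. Qed.

Variable nabla : connection M.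
Hypothesis nablaP : is_levi_civita g nabla.
Let nablaC := levi_civita_connection nablaP.

(** Vanishing torsion yields symmetric Christoffel symbols because coordinate
    fields commute; metric compatibility on coordinate fields, transported from
    the chart at q to the chart at p, is the formula for the derivative of the
    metric coefficients. *)
Lemma levi_civita_coordinate_metric p :
  coordinate_metric (crd p @` src p) (christoffel nabla p) (coordinate_inner p).
Proof.
split.
- exact: target_open.
- by move=> u y; exact: christoffel_linl.
- by move=> u x; exact: christoffel_linr.
- exact: christoffel_smooth.
- move=> _ x y [q pq <-]; rewrite !christoffelE//; congr components.
  have cs a := smooth_near_const_field a pq.
  have := levi_civita_torsion_free nablaP (cs x) (cs y).
  by rewrite lie_bracket_const_field// => /subr0_eq.
- by move=> u y _ k x z; rewrite /coordinate_inner const_field_linear inner_linl.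
- by move=> u y _ k x z; rewrite /coordinate_inner const_field_linear inner_linr.
- exact: coordinate_inner_smooth.
- by move=> u x y _; exact: inner_sym.
- move=> _ h x y [q pq <-].
  have cs a := smooth_near_const_field a pq.
  rewrite /coordinate_inner !christoffelE// !(crdK pq) !(componentsK _ pq).
  rewrite -(levi_civita_metric nablaP)// dfunE const_fieldE.
  apply: (dir_change_chart
    (F := fun q => inner g q (const_field p x q) (const_field p y q))) => //.
    exact: srcp.
  apply: smooth_differentiable (@gram_smooth _ _ _ g p x y q) _.
  by exists q => //; split=> //; exact: srcp.
Qed.

End MetricInCoordinates.

(** * Symmetries of the curvature tensor *)

Section RiemannSymmetries.
Context {R : realType} {m : nat} {M : manifold R m}.
Variables (g : riemannian_metric M) (nabla : connection M).
Hypothesis nablaP : is_levi_civita g nabla.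
Implicit Types (p : M) (x y z w : 'rV[R]_m).

Let nablaC := levi_civita_connection nablaP.
Let cm := levi_civita_coordinate_metric nablaP.
Let crdp p : (crd p @` src p) (crd p p).
Proof. by exists p => //; exact: srcp. Qed.

Lemma Rm_coordinate p w x y z : Rm g nabla p w x y z =
  coordinate_inner g p (crd p p)
    (coordinate_curvature (christoffel nabla p) (crd p p) w x y) z.
Proof. by rewrite /Rm curvature_in_chart// coordinate_inner_self. Qed.

Lemma Rm_pair p w x y z : Rm g nabla p w x y z = Rm g nabla p y z w x.
Proof. by rewrite !Rm_coordinate (coordinate_curvature_pair (cm p)). Qed.

Lemma Rm_antisym12 p w x y z : Rm g nabla p w x y z = - Rm g nabla p x w y z.
Proof.
rewrite !Rm_coordinate coordinate_curvature_antisym.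
by rewrite (linN _ (cm_linl (cm p) _ (crdp p))).
Qed.

Lemma Rm_antisym34 p w x y z : Rm g nabla p w x y z = - Rm g nabla p w x z y.
Proof. by rewrite Rm_pair Rm_antisym12 Rm_pair. Qed.

(** The symmetry that lets the middle arguments of R(N, x, y, N) be exchanged,
    and hence makes the Ricci tensor symmetric. *)
Lemma Rm_swap_inner p w x y z : Rm g nabla p w x y z = Rm g nabla p z y x w.
Proof. by rewrite Rm_pair Rm_antisym12 Rm_antisym34 opprK. Qed.

(** Linearity in one argument is read off from the coordinate expression; the
    other arguments follow by the symmetries. *)
Lemma Rm_lin1 p x y z : linear (fun w => Rm g nabla p w x y z : R).
Proof.
move=> k w1 w2; rewrite /Rm !curvature_in_chart// /coordinate_curvature.
have [oO Ou] := (cm_open (cm p), crdp p).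
have l2 c := cm_christoffel_linl (cm p) c Ou.
have Gs a b := cm_christoffel_smooth (cm p) a b.
have -> : dir (fun q => christoffel nabla p q (k *: w1 + w2) y) (crd p p) x =
    k *: dir (fun q => christoffel nabla p q w1 y) (crd p p) x
    + dir (fun q => christoffel nabla p q w2 y) (crd p p) x.
  rewrite (dir_eq_on x oO Ou _ (Gs _ _) (g := fun q => k *: christoffel nabla p q w1 y
    + christoffel nabla p q w2 y)); last first.
    by move=> q Oq; rewrite (cm_christoffel_linl (cm p) y Oq).
  have d1 := smooth_differentiable (Gs w1 y) Ou.
  rewrite dirD ?dirZ//.
  - exact: differentiableZ.
  - exact: smooth_differentiable (Gs w2 y) Ou.
rewrite (dir_linear _ _ k) !(l2 _ k).
rewrite (cm_christoffel_linr (cm p) _ Ou k) -inner_linl; congr inner.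
by apply/rowP => i; rewrite !mxE; ring.
Qed.

Lemma Rm_lin3 p w x z : linear (fun y => Rm g nabla p w x y z : R).
Proof. by move=> k y1 y2; rewrite !(Rm_pair p w) Rm_lin1. Qed.

Lemma Rm_lin4 p w x y : linear (fun z => Rm g nabla p w x y z : R).
Proof. by move=> k z1 z2; rewrite /Rm inner_linr. Qed.

(** The sharp of a form represents it only if the form is linear. *)
Lemma ricci_linear p (F : 'I_m -> 'rV[R]_m) x :
  linear (ricci g nabla p F x : 'rV[R]_m -> R).
Proof.
move=> k y z; rewrite /ricci scaler_sumr -big_split; apply: eq_bigr => a _ /=.
exact: Rm_lin3.
Qed.

Lemma inner_ricci_op p (F : 'I_m -> 'rV[R]_m) x y :
  inner g p (ricci_op g nabla p F x) y = ricci g nabla p F x y.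
Proof. by rewrite /ricci_op inner_sharp//; exact: ricci_linear. Qed.

End RiemannSymmetries.

(** * The second fundamental form *)

Section Immersion.
Context {R : realType} {n m : nat} {M : manifold R n} {Mt : manifold R m}.
Variables (g : riemannian_metric M) (gt : riemannian_metric Mt).
Variables (iota : M -> Mt).
Hypothesis iotaP : is_riemannian_submanifold g gt iota.
Implicit Types (p q : M) (x y z : 'rV[R]_n) (w eta : 'rV[R]_m).

Let smoothP : smooth_map iota.
Proof. by case: iotaP => [[]]. Qed.

(** The embedding read in the charts at p and at its image. *)
Definition chart_map p u : 'rV[R]_m := crd (iota p) (iota (prm p u)).
(** The part of M on which [chart_map p] reads the embedding. *)
Definition chart_dom p : set M := iota @^-1` src (iota p).

Lemma chart_dom_open p : open (chart_dom p).
Proof.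
have [cont _] := smoothP; move/continuousP: cont; apply; exact: src_open.
Qed.

Lemma chart_map_smooth p :
  smooth_on (crd p @` (chart_dom p `&` src p)) (chart_map p).
Proof. by have [_ /(_ p (iota p))] := smoothP; rewrite setIC. Qed.

Lemma local_map_differentiable p (b : Mt) q : src p q -> src b (iota q) ->
  differentiable (fun u => crd b (iota (prm p u))) (crd p q).
Proof.
move=> pq bq; have [_ /(_ p b) s] := smoothP.
by apply: smooth_differentiable s _; exists q.
Qed.

Lemma tangent_mapE p x : tangent_map iota p x = dir (chart_map p) (crd p p) x.
Proof. by rewrite dirE. Qed.

Lemma tangent_map_linear p : linear (tangent_map iota p).
Proof. by move=> k x y; rewrite !tangent_mapE dir_linear. Qed.

(** The differential of the embedding, read in the charts at q, agrees with its
    differential read in the charts at p. *)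
Lemma tangent_map_const_field p q x : src p q -> chart_dom p q ->
  tangent_map iota q (const_field p x q) =
  const_field (iota p) (dir (chart_map p) (crd p q) x) (iota q).
Proof.
move=> pq dq; have qq := srcp q; have iq := srcp (iota q).
rewrite tangent_mapE !const_fieldE.
rewrite -(dir_change_chart (F := fun r => crd (iota q) (iota r)))//; last first.
  exact: local_map_differentiable.
have e : chart_map p (crd p q) = crd (iota p) (iota q).
  by rewrite /chart_map crdK.
rewrite -e -(dir_comp (f := chart_map p)
  (g := fun v => crd (iota q) (prm (iota p) v))).
- apply: dir_near_eq; last exact: local_map_differentiable.
  have := near_crd (chart_dom_open p) pq dq; apply: filterS => u [du pu].
  by rewrite /chart_map crdK.
- exact: local_map_differentiable.
- by rewrite e; exact: transition_differentiable.
Qed.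

Lemma inner_tangent_map p x y :
  inner gt (iota p) (tangent_map iota p x) (tangent_map iota p y) = inner g p x y.
Proof. by have [_ ->] := iotaP. Qed.

(** In charts the isometry condition holds on a whole open set, which is what
    allows its differentiation. *)
Lemma coordinate_isometry p u x y : (crd p @` (chart_dom p `&` src p)) u ->
  coordinate_inner g p u x y =
  coordinate_inner gt (iota p) (chart_map p u)
    (dir (chart_map p) u x) (dir (chart_map p) u y).
Proof.
move=> [q [dq pq] <-]; rewrite /coordinate_inner.
have -> : prm (iota p) (chart_map p (crd p q)) = iota q.
  by rewrite /chart_map !crdK.
by rewrite crdK// -inner_tangent_map !tangent_map_const_field.
Qed.

Lemma tangent_part_unique p w x :
  (forall z, inner gt (iota p) w (tangent_map iota p z) = inner g p x z) ->
  tangent_part g gt iota p w = x.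
Proof.
move=> wx; apply: (inner_ext (g := g) (p := p)) => z.
rewrite /tangent_part inner_sharp ?wx//.
by move=> k a b; rewrite tangent_map_linear inner_linr.
Qed.

Lemma inner_tangent_part p w z :
  inner g p (tangent_part g gt iota p w) z =
  inner gt (iota p) w (tangent_map iota p z).
Proof.
rewrite /tangent_part inner_sharp//.
by move=> k a b; rewrite tangent_map_linear inner_linr.
Qed.

Lemma normal_part_normal p w z :
  inner gt (iota p) (normal_part g gt iota p w) (tangent_map iota p z) = 0.
Proof.
rewrite /normal_part (linB _ _ (inner_linl gt _ _)) /=.
by rewrite inner_tangent_map inner_tangent_part subrr.
Qed.

Variables (nabla : connection M) (nablat : connection Mt).
Hypothesis nablaP : is_levi_civita g nabla.
Hypothesis nablatP : is_levi_civita gt nablat.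
Let nablaC := levi_civita_connection nablaP.
Let nablatC := levi_civita_connection nablatP.
Let cmt p := levi_civita_coordinate_metric nablatP (iota p).

Let chart_map_self p : chart_map p (crd p p) = crd (iota p) (iota p).
Proof. by rewrite /chart_map (crdK (srcp p)). Qed.

Let crdp p : (crd p @` (chart_dom p `&` src p)) (crd p p).
Proof. by exists p => //; split; exact: srcp. Qed.

Let cm p : coordinate_metric (crd p @` (chart_dom p `&` src p))
  (christoffel nabla p) (coordinate_inner g p).
Proof.
have sub : crd p @` (chart_dom p `&` src p) `<=` crd p @` src p.
  by move=> u [q [_ pq] <-]; exists q.
have [_ l1 l2 s sy g1 g2 gs gsy co] := levi_civita_coordinate_metric nablaP p.
split.
- exact: (open_crd_image (chart_dom_open p)).
- by move=> u y /sub; exact: l1.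
- by move=> u y /sub; exact: l2.
- by move=> x y; exact: smooth_sub (s x y).
- by move=> u x y /sub; exact: sy.
- by move=> u y /sub; exact: g1.
- by move=> u y /sub; exact: g2.
- by move=> x y; exact: smooth_sub (gs x y).
- by move=> u x y /sub; exact: gsy.
- by move=> u h x y /sub; exact: co.
Qed.

Let chart_map_target p u : (crd p @` (chart_dom p `&` src p)) u ->
  (crd (iota p) @` src (iota p)) (chart_map p u).
Proof. by move=> [q [dq pq] <-]; exists (iota q); rewrite // /chart_map crdK. Qed.

Local Notation II := (second_form g gt iota nablat).
Local Notation IIc p := (coordinate_second_form (Gam := christoffel nabla p)
  (Gamt := christoffel nablat (iota p)) (f := chart_map p)).

Lemma cov_along_coordinate_field p x y :
  cov_along iota nablat p x (fun q => tangent_map iota q (const_field p y q)) =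
  cov_dir (Gamt := christoffel nablat (iota p)) (f := chart_map p)
    (fun u => dir (chart_map p) u y) (crd p p) x.
Proof.
rewrite /cov_along /cov_dir const_field_self chart_map_self -!tangent_mapE.
congr (_ + _); last first.
  rewrite [RHS](linear_row_sum _ (christoffel_linr nablatC _ _)); last first.
    by exists (iota p) => //; exact: srcp.
  by apply: eq_bigr => a _; rewrite christoffel_self.
rewrite -dirE; apply/esym.
apply: (dir_eq_on _ (cm_open (cm p)) (crdp p) _ (smooth_dir y (@chart_map_smooth p))).
move=> _ [q [dq pq] <-]; rewrite /local_rep_along crdK//.
by rewrite tangent_map_const_field// const_fieldK.
Qed.

(** In charts the covariant derivative is II + df (Gamma(x, y)) with II
    normal, so that its tangential part is Gamma(x, y). *)
Lemma second_form_coordinate p x y : II p x y = IIc p (crd p p) x y.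
Proof.
rewrite /second_form /normal_part cov_along_coordinate_field.
rewrite /coordinate_second_form -tangent_mapE; congr (_ - tangent_map iota p _).
apply: tangent_part_unique => z.
have := coordinate_second_form_normal (cm p) (cmt p) (@chart_map_smooth p)
  (@chart_map_target p) (@coordinate_isometry p) x y z (crdp p).
rewrite chart_map_self coordinate_inner_self -tangent_mapE.
rewrite /coordinate_second_form (linB _ _ (inner_linl gt _ _)) /= -tangent_mapE.
by move=> /eqP; rewrite subr_eq0 inner_tangent_map => /eqP.
Qed.

Lemma second_form_normal p x y z :
  inner gt (iota p) (II p x y) (tangent_map iota p z) = 0.
Proof. exact: normal_part_normal. Qed.

Lemma second_form_sym p x y : II p x y = II p y x.
Proof.
rewrite !second_form_coordinate /coordinate_second_form.
rewrite (cov_dir_sym (cm p) (cmt p) (@chart_map_smooth p) (@chart_map_target p))//.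
by rewrite (cm_christoffel_sym (cm p)).
Qed.

Lemma second_form_linl p y : linear (fun x => II p x y).
Proof.
move=> k x z; rewrite !second_form_coordinate /coordinate_second_form /cov_dir.
rewrite !(dir_linear _ _ k) (christoffel_linl nablatC) ?(christoffel_linl nablaC).
- rewrite (dir_linear _ _ k).
  by apply/rowP => i; rewrite !mxE; ring.
- by exists p => //; exact: srcp.
- exact/chart_map_target/crdp.
Qed.

Lemma second_form_linr p x : linear (fun y => II p x y).
Proof. by move=> k y z; rewrite !(second_form_sym p x) second_form_linl. Qed.

Theorem gauss_equation p (t x y z : 'rV[R]_n) :
  Rm gt nablat (iota p) (tangent_map iota p t) (tangent_map iota p x)
    (tangent_map iota p y) (tangent_map iota p z) =
  Rm g nabla p t x y z + inner gt (iota p) (II p t y) (II p x z)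
  - inner gt (iota p) (II p x y) (II p t z).
Proof.
rewrite !Rm_coordinate// !second_form_coordinate !tangent_mapE.
have := coordinate_gauss_equation (cm p) (cmt p) (@chart_map_smooth p)
  (@chart_map_target p) (@coordinate_isometry p) t x y z (crdp p).
by rewrite chart_map_self !coordinate_inner_self.
Qed.

Lemma inner_weingarten p eta x y :
  inner g p (weingarten g gt iota nablat p eta x) y =
  inner gt (iota p) eta (II p x y).
Proof.
rewrite /weingarten inner_sharp//.
by move=> k a b; rewrite second_form_linr inner_linr.
Qed.

Lemma weingarten_linear p eta : linear (weingarten g gt iota nablat p eta).
Proof.
move=> k x y; apply: (inner_ext (g := g) (p := p)) => z.
rewrite inner_weingarten second_form_linl (inner_linr gt) (inner_linl g).
by rewrite -(inner_weingarten p eta x z) -(inner_weingarten p eta y z).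
Qed.

Lemma weingarten_linear_normal p x :
  linear (fun eta => weingarten g gt iota nablat p eta x).
Proof.
move=> k a b; apply: (inner_ext (g := g) (p := p)) => z.
rewrite inner_weingarten (inner_linl gt) (inner_linl g).
by rewrite -(inner_weingarten p a x z) -(inner_weingarten p b x z).
Qed.

End Immersion.

(** * Orthonormal bases *)

Section OrthonormalBases.
Context {R : realType} {m : nat} {M : manifold R m}.
Variables (g : riemannian_metric M) (p : M).
Implicit Types (x y z : 'rV[R]_m).

Section Frame.
Variables (F : 'I_m -> 'rV[R]_m) (Fon : orthonormal_vectors g p F).

Let P : 'M[R]_m := \matrix_(i, j) F i 0 j.

Let rowPE i : row i P = F i.
Proof. by apply/rowP => j; rewrite !mxE. Qed.

Let PGP : P *m gram g p *m P^T = 1%:M.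
Proof.
apply/matrixP => i j; rewrite [RHS]mxE -Fon /inner -!rowPE.
rewrite -row_mul tr_row.
by rewrite mxE [RHS]mxE; apply: eq_bigr => k _; rewrite !mxE.
Qed.

(** The matrix P with rows F_a satisfies P G P^T = 1, so P^T is invertible. *)
Lemma orthonormal_eq0 x : (forall a, inner g p x (F a) = 0) -> x = 0.
Proof.
move=> x0; have [_ Pu] := mulmx1_unit PGP.
have xGP : x *m gram g p *m P^T = 0.
  apply/rowP => a; rewrite [RHS]mxE -(x0 a) /inner -rowPE.
  by rewrite !mxE; apply: eq_bigr => k _; rewrite !mxE.
have := congr1 (mulmx^~ (invmx (gram g p))) (congr1 (mulmx^~ (invmx P^T)) xGP).
by rewrite /= !mul0mx mulmxK// mulmxK ?gram_unit.
Qed.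

Lemma orthonormal_expansion x : x = \sum_a inner g p x (F a) *: F a.
Proof.
apply: subr0_eq; apply: orthonormal_eq0 => b.
rewrite (linB _ _ (inner_linl g p _)) (lin_sum _ (inner_linl g p _)) /=.
rewrite (bigD1 b)//= big1 => [|a ab].
  by rewrite addr0 (linZ _ _ (inner_linl g p _)) /= Fon eqxx scaler1 ?mulr1 subrr.
by rewrite (linZ _ _ (inner_linl g p _)) /= Fon (negbTE ab) scaler0.
Qed.

Lemma inner_expansion x y :
  inner g p x y = \sum_a inner g p x (F a) * inner g p y (F a).
Proof.
rewrite {1}(orthonormal_expansion x) (lin_sum _ (inner_linl g p _)) /=.
apply: eq_bigr => a _.
by rewrite (linZ _ _ (inner_linl g p _)) /= [inner g p (F a) y]inner_sym.
Qed.

(** With P as above, the right-hand side is the trace of P A G P^T, where A is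
    the matrix of L; and G P^T P = 1. *)
Lemma trace_orthonormal (L : 'rV[R]_m -> 'rV[R]_m) : linear L ->
  \tr (lin1_mx L) = \sum_a inner g p (L (F a)) (F a).
Proof.
move=> Ll.
have LE x : L x = x *m lin1_mx L.
  rewrite (linear_row_sum x Ll) mulmx_sum_row; apply: eq_bigr => i _.
  by congr (_ *: _); apply/rowP => j; rewrite !mxE.
have GPP : gram g p *m P^T *m P = 1%:M by apply: mulmx1C; rewrite mulmxA.
transitivity (\tr (P *m lin1_mx L *m gram g p *m P^T)).
  by rewrite -!mulmxA mxtrace_mulC -!mulmxA [gram g p *m _]mulmxA GPP mulmx1.
rewrite /mxtrace; apply: eq_bigr => a _; rewrite LE /inner -rowPE -!row_mul tr_row.
by rewrite mxE [RHS]mxE [RHS]mxE; apply: eq_bigr => k _; rewrite !mxE.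
Qed.

End Frame.

(** Both sums equal the double sum of <F_a, E_b> B(E_b, F_a): expand the F_a
    in the basis E, or the E_b in the basis F. *)
Lemma bilinear_trace (F E : 'I_m -> 'rV[R]_m) (B : 'rV[R]_m -> 'rV[R]_m -> R) :
  orthonormal_vectors g p F -> orthonormal_vectors g p E ->
  (forall y, linear (fun x => B x y : R)) -> (forall x, linear (fun y => B x y : R)) ->
  \sum_a B (F a) (F a) = \sum_a B (E a) (E a).
Proof.
move=> Fon Eon B1 B2.
transitivity (\sum_a \sum_b inner g p (F a) (E b) * B (E b) (F a)).
  apply: eq_bigr => a _; rewrite {1}(orthonormal_expansion Eon (F a)).
  rewrite (lin_sum _ (B1 _)); apply: eq_bigr => b _.
  by rewrite (linZ _ _ (B1 _)).
rewrite exchange_big; apply: eq_bigr => b _ /=.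
rewrite [X in _ = B _ X](orthonormal_expansion Fon (E b)) (lin_sum _ (B2 _)).
by apply: eq_bigr => a _; rewrite (linZ _ _ (B2 _)) inner_sym.
Qed.

End OrthonormalBases.

(** * The tangential part of the ambient Ricci operator *)

Section RicciFormula.
Context {R : realType} {n k : nat} {M : manifold R n} {Mt : manifold R (n + k)}.
Variables (g : riemannian_metric M) (gt : riemannian_metric Mt).
Variables (iota : M -> Mt) (nabla : connection M) (nablat : connection Mt).
Hypothesis iotaP : is_riemannian_submanifold g gt iota.
Hypothesis nablaP : is_levi_civita g nabla.
Hypothesis nablatP : is_levi_civita gt nablat.
Variables (p : M) (E : 'I_n -> 'rV[R]_n) (N : 'I_k -> 'rV[R]_(n + k)).
Hypothesis Eon : orthonormal_vectors g p E.
Hypothesis Non : orthonormal_vectors gt (iota p) N.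
Hypothesis Nnormal : forall l y,
  inner gt (iota p) (N l) (tangent_map iota p y) = 0.

Local Notation d := (tangent_map iota p).
Local Notation II := (second_form g gt iota nablat p).
Local Notation W := (weingarten g gt iota nablat p).
Local Notation "<< x , y >>" := (inner gt (iota p) x y).

Definition adapted_basis (a : 'I_(n + k)) : 'rV[R]_(n + k) :=
  match fintype.split a with inl i => d (E i) | inr l => N l end.

Lemma adapted_basisl i : adapted_basis (lshift k i) = d (E i).
Proof. by rewrite /adapted_basis (unsplitK (inl i)). Qed.

Lemma adapted_basisr l : adapted_basis (rshift n l) = N l.
Proof. by rewrite /adapted_basis (unsplitK (inr l)). Qed.

Lemma adapted_basis_orthonormal : orthonormal_vectors gt (iota p) adapted_basis.
Proof.
move=> a b; case: (split_ordP a) => i ->; case: (split_ordP b) => j ->.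
- by rewrite !adapted_basisl (inner_tangent_map iotaP) Eon eq_lshift.
- by rewrite adapted_basisl adapted_basisr inner_sym Nnormal eq_lrshift.
- by rewrite adapted_basisl adapted_basisr Nnormal eq_rlshift.
- by rewrite !adapted_basisr Non eq_rshift.
Qed.

(** In the adapted basis the tangential coefficients vanish. *)
Lemma normal_expansion xi : (forall z, <<xi, d z>> = 0) ->
  xi = \sum_l <<xi, N l>> *: N l.
Proof.
move=> xin; rewrite [LHS](orthonormal_expansion adapted_basis_orthonormal).
rewrite big_split_ord /= big1 ?add0r => [|i _].
  by apply: eq_bigr => l _; rewrite adapted_basisr.
by rewrite adapted_basisl xin scale0r.
Qed.

Lemma normal_inner_expansion xi eta : (forall z, <<xi, d z>> = 0) ->
  <<xi, eta>> = \sum_l <<N l, xi>> * <<N l, eta>>.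
Proof.
move=> xin; rewrite {1}(normal_expansion xin) (lin_sum _ (inner_linl _ _ _)) /=.
apply: eq_bigr => l _.
by rewrite (linZ _ _ (inner_linl _ _ _)) /= [<<xi, N l>>]inner_sym.
Qed.

(** The trace of the Gauss equation over an orthonormal basis of the tangent
    space.  Expanding II(E_i, y) in the normal frame turns the sum over i of
    <II(E_i, y), II(v, E_i)> into the sum over l of <W_l y, W_l v>, and the
    Weingarten maps are self-adjoint. *)
Lemma ricci_gauss v y :
  \sum_i Rm gt nablat (iota p) (d (E i)) (d v) (d y) (d (E i)) =
  ricci g nabla p E v y + \sum_l inner g p (W (N l) (W (N l) v)) y
  - inner g p (W (\sum_i II (E i) (E i)) v) y.
Proof.
under eq_bigr do rewrite (gauss_equation iotaP nablaP nablatP).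
rewrite sumrB big_split; congr (_ + _ - _).
- under eq_bigr => i _ do rewrite (normal_inner_expansion _ (second_form_normal iotaP _ _ _ _)).
  rewrite exchange_big; apply: eq_bigr => l _ /=.
  rewrite (inner_weingarten iotaP nablaP nablatP) (second_form_sym iotaP nablaP nablatP).
  rewrite -(inner_weingarten iotaP nablaP nablatP) (inner_expansion Eon).
  have WE := inner_weingarten iotaP nablaP nablatP p (N l).
  apply: eq_bigr => i _; congr (_ * _); last exact: esym (WE _ _).
  by rewrite (second_form_sym iotaP nablaP nablatP); exact: esym (WE _ _).
- rewrite (inner_weingarten iotaP nablaP nablatP) (lin_sum _ (inner_linl _ _ _)) /=.
  by apply: eq_bigr => i _; rewrite inner_sym.
Qed.

(** The trace defining the ambient Ricci tensor is computed in the adapted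
    basis, whose tangential part is [ricci_gauss]; the inner product with an
    arbitrary tangent vector y identifies the tangential component. *)
Lemma tangent_part_ricci_op (F : 'I_n -> 'rV[R]_n) (Ft : 'I_(n + k) -> 'rV[R]_(n + k)) v :
  orthonormal_vectors g p F -> orthonormal_vectors gt (iota p) Ft ->
  tangent_part g gt iota p (ricci_op gt nablat (iota p) Ft (d v)) =
  ricci_op g nabla p F v - W (\sum_i II (E i) (E i)) v +
  \sum_l (W (N l) (W (N l) v) +
     \sum_i Rm gt nablat (iota p) (N l) (d (E i)) (d v) (N l) *: E i).
Proof.
move=> Fon Fton; apply: tangent_part_unique => y.
rewrite (inner_ricci_op nablatP) /ricci.
rewrite (bilinear_trace (B := fun a b => Rm gt nablat (iota p) a (d v) (d y) b)
  Fton adapted_basis_orthonormal); first last.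
- by move=> x; exact: Rm_lin4.
- by move=> x; exact: (Rm_lin1 nablatP).
rewrite big_split_ord /=; under eq_bigr do rewrite adapted_basisl.
under [X in _ + X]eq_bigr do rewrite adapted_basisr.
rewrite ricci_gauss.
rewrite (linD _ _ (inner_linl g p y)) (linB _ _ (inner_linl g p y)) /=.
rewrite (inner_ricci_op nablaP) (lin_sum _ (inner_linl g p y)) /=.
have -> : ricci g nabla p F v y = ricci g nabla p E v y.
  apply: (bilinear_trace (B := fun a b => Rm g nabla p a v y b) Fon Eon).
  - by move=> x; exact: (Rm_lin1 nablaP).
  - by move=> x; exact: Rm_lin4.
rewrite [X in _ = _ + X](eq_bigr _
  (fun l _ => linD _ _ (inner_linl g p y))) [X in _ = _ + X]big_split /=.
rewrite -!addrA; congr (_ + _).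
rewrite [RHS]addrCA; congr (_ + _); congr (_ + _).
apply: eq_bigr => l _; rewrite (lin_sum _ (inner_linl g p y)) /=.
have dl := tangent_map_linear iota p.
have Rl := Rm_lin3 nablatP (iota p) (N l) (d v) (N l).
rewrite {1}(orthonormal_expansion Eon y) (lin_sum _ dl) (lin_sum _ Rl) /=.
apply: eq_bigr => i _; rewrite (linZ _ _ dl) (linZ _ _ Rl) /=.
rewrite (linZ _ _ (inner_linl g p y)) /= [LHS]mulrC (Rm_swap_inner nablatP).
by rewrite [inner g p y _]inner_sym.
Qed.

End RicciFormula.

(** * Flatness of Euclidean space *)

Section EuclideanFlat.
Context {R : realType} {m : nat}.
Variable nabla : connection (euclidean_space R m).
Hypothesis nablaP : is_levi_civita (euclidean_metric R m) nabla.

Let inner_const p u a b : coordinate_inner (euclidean_metric R m) p u a b =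
  inner (euclidean_metric R m) u a b.
Proof. by rewrite /coordinate_inner /const_field !diff_idE. Qed.

Let crd_all p (u : 'rV[R]_m) : (crd (p : euclidean_space R m) @` src p) u.
Proof. by exists u. Qed.

(** The metric coefficients are constant, so the form <Gamma(x, y), z>
    and the zero form both satisfy the hypotheses of Koszul's argument. *)
Lemma euclidean_christoffel (p : euclidean_space R m) u x y :
  christoffel nabla p u x y = 0.
Proof.
have cm := levi_civita_coordinate_metric nablaP p.
have sym a b c := cm_sym cm b c (crd_all p a).
apply: (inner_eq0 (g := euclidean_metric R m) (p := u)) => z.
rewrite -(inner_const p); move: x y z.
apply: (koszul_unique (S' := fun _ _ _ => 0)) => // x y z.
  by rewrite (cm_christoffel_sym cm).
rewrite (sym u (christoffel nabla p u x z)) addr0 -(cm_compat cm)//.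
rewrite -[RHS](dir_cst (inner (euclidean_metric R m) p y z) u x).
congr (dir _ u x); apply/funext => q; exact: inner_const.
Qed.

Lemma euclidean_flat p w x y z :
  Rm (euclidean_metric R m) nabla p w x y z = 0.
Proof.
have cm := levi_civita_coordinate_metric nablaP p.
have Gam0 a b : (fun q => christoffel nabla p q a b) = fun=> 0.
  by apply/funext => u; exact: euclidean_christoffel.
rewrite (Rm_coordinate nablaP) /coordinate_curvature !Gam0 !dir_cst.
rewrite !euclidean_christoffel subr0 addr0 subr0.
by rewrite (lin0 (cm_linl cm _ (crd_all p _))).
Qed.

End EuclideanFlat.

(** * Mean curvature and special ambient spaces *)

Section MeanCurvature.
Context {R : realType} {n m : nat} {M : manifold R n} {Mt : manifold R m}.
Variables (g : riemannian_metric M) (gt : riemannian_metric Mt).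
Variables (iota : M -> Mt) (nabla : connection M) (nablat : connection Mt).
Hypothesis iotaP : is_riemannian_submanifold g gt iota.
Hypothesis nablaP : is_levi_civita g nabla.
Hypothesis nablatP : is_levi_civita gt nablat.

Lemma scale_weingarten_mean_curvature (E : 'I_n -> M -> 'rV[R]_n) p v :
  (0 < n)%N ->
  n%:R *: weingarten g gt iota nablat p
    (mean_curvature_vector g gt iota nablat E p) v =
  weingarten g gt iota nablat p
    (\sum_i second_form g gt iota nablat p (E i p) (E i p)) v.
Proof.
move=> n0; have Wl := weingarten_linear_normal iotaP nablaP nablatP p v.
rewrite /mean_curvature_vector (linZ _ _ Wl) scalerA mulfV ?scale1r//.
by rewrite pnatr_eq0 -lt0n.
Qed.

End MeanCurvature.

Section Hypersurface.
Context {R : realType} {n : nat} {M : manifold R n} {Mt : manifold R (n + 1)}.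
Variables (g : riemannian_metric M) (gt : riemannian_metric Mt).
Variables (iota : M -> Mt) (nabla : connection M) (nablat : connection Mt).
Hypothesis iotaP : is_riemannian_submanifold g gt iota.
Hypothesis nablaP : is_levi_civita g nabla.
Hypothesis nablatP : is_levi_civita gt nablat.

(** The normal space is the line of N, so II(E_i, E_i) = <s E_i, E_i> N, and
    the coefficients add up to the trace of s. *)
Lemma weingarten_sum_second_form p (E : 'I_n -> 'rV[R]_n) (N : 'rV[R]_(n + 1)) v :
  (0 < n)%N -> orthonormal_vectors g p E ->
  orthonormal_vectors gt (iota p) (fun _ : 'I_1 => N) ->
  (forall y, inner gt (iota p) N (tangent_map iota p y) = 0) ->
  weingarten g gt iota nablat p (\sum_i second_form g gt iota nablat p (E i) (E i)) v =
  (n%:R * mean_curvature g gt iota nablat p N) *: weingarten g gt iota nablat p N v.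
Proof.
move=> n0 Eon Non Nn; have Wl := weingarten_linear_normal iotaP nablaP nablatP p v.
rewrite /mean_curvature mulrA mulfV ?mul1r ?pnatr_eq0 -?lt0n//.
rewrite (trace_orthonormal Eon (weingarten_linear iotaP nablaP nablatP p N)).
rewrite (lin_sum _ Wl) /= scaler_suml; apply: eq_bigr => i _.
rewrite (inner_weingarten iotaP nablaP nablatP) -(linZ _ _ Wl) /=.
have Nn' (l : 'I_1) y : inner gt (iota p) N (tangent_map iota p y) = 0 by exact: Nn.
rewrite [X in weingarten g gt iota nablat p X v](normal_expansion iotaP Eon Non Nn'
  (second_form_normal iotaP _ _ _ _)).
by rewrite big_ord1 inner_sym.
Qed.

End Hypersurface.

Section Euclidean.
Context {R : realType} {n k : nat} {M : manifold R n}.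
Let Mt := euclidean_space R (n + k).
Let gt := euclidean_metric R (n + k).
Variables (g : riemannian_metric M).
Variables (iota : M -> Mt) (nabla : connection M) (nablat : connection Mt).
Hypothesis iotaP : is_riemannian_submanifold g gt iota.
Hypothesis nablaP : is_levi_civita g nabla.
Hypothesis nablatP : is_levi_civita gt nablat.

(** With R~ = 0 the tangential part of the ambient Ricci operator is 0, and
    the general formula can be solved for the intrinsic one. *)
Lemma ricci_op_euclidean_submanifold (p : M) (E F : 'I_n -> 'rV[R]_n)
    (N : 'I_k -> 'rV[R]_(n + k)) v :
  orthonormal_vectors g p E -> orthonormal_vectors g p F ->
  orthonormal_vectors gt (iota p) N ->
  (forall l y, inner gt (iota p) (N l) (tangent_map iota p y) = 0) ->
  let W := weingarten g gt iota nablat p in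
  ricci_op g nabla p F v =
  W (\sum_i second_form g gt iota nablat p (E i) (E i)) v
  - \sum_l W (N l) (W (N l) v).
Proof.
move=> Eon Fon Non Nn W.
have := tangent_part_ricci_op iotaP nablaP nablatP Eon Non Nn v Fon
  (adapted_basis_orthonormal iotaP Eon Non Nn).
have -> : ricci_op gt nablat (iota p) (adapted_basis iota p E N)
    (tangent_map iota p v) = 0.
  apply: (inner_ext (g := gt) (p := iota p)) => y.
  rewrite (inner_ricci_op nablatP) (lin0 (inner_linl gt _ y)) /ricci big1//= => a _.
  exact: euclidean_flat.
rewrite (tangent_part_unique (x := 0)); last first.
  by move=> z; rewrite (lin0 (inner_linl gt _ _)) (lin0 (inner_linl g _ _)).
rewrite [X in _ + X](eq_bigr (fun l => W (N l) (W (N l) v))) => [|l _].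
  by move=> e; apply: subr0_eq; rewrite [RHS]e opprB addrA [LHS]addrAC.
by rewrite [X in _ + X]big1 ?addr0// => i _; rewrite euclidean_flat// scale0r.
Qed.

End Euclidean.

Theorem theorem1p9 (R : realType) :
  (* arbitrary codimension *)
  (forall (n k : nat), (0 < n)%N -> (0 < k)%N ->
   forall (M : manifold R n) (Mt : manifold R (n + k))
     (g : riemannian_metric M) (gt : riemannian_metric Mt) (iota : M -> Mt)
     (nabla : connection M) (nablat : connection Mt),
   is_riemannian_submanifold g gt iota ->
   is_levi_civita g nabla -> is_levi_civita gt nablat ->
   forall (v : M -> 'rV[R]_n) (p : M) (vt : Mt -> 'rV[R]_(n + k)),
   smooth_field_on setT v -> extends_near iota p v vt ->
   forall (U : set M) (E : 'I_n -> M -> 'rV[R]_n)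
     (N : 'I_k -> M -> 'rV[R]_(n + k)),
   open_nbhs p U -> orthonormal_frame_on g U E ->
   normal_frame_on gt iota U N ->
   forall (F : 'I_n -> 'rV[R]_n) (Ft : 'I_(n + k) -> 'rV[R]_(n + k)),
   orthonormal_vectors g p F -> orthonormal_vectors gt (iota p) Ft ->
   let W := weingarten g gt iota nablat p in
   let H := mean_curvature_vector g gt iota nablat E p in
   let d := tangent_map iota p in
   let Rict := ricci_op gt nablat (iota p) Ft (vt (iota p)) in
   Rict = d (ricci_op g nabla p F (v p) - n%:R *: W H (v p) +
             \sum_(l < k)
               (W (N l p) (W (N l p) (v p)) +
                \sum_(i < n) Rm gt nablat (iota p) (N l p) (d (E i p))
                                (vt (iota p)) (N l p) *: E i p))
          + normal_part g gt iota p Rict)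
  /\
  (* submanifolds of Euclidean space *)
  (forall (n k : nat), (0 < n)%N -> (0 < k)%N ->
   forall (M : manifold R n) (g : riemannian_metric M)
     (iota : M -> euclidean_space R (n + k))
     (nabla : connection M) (nablat : connection (euclidean_space R (n + k))),
   let gt := euclidean_metric R (n + k) in
   is_riemannian_submanifold g gt iota ->
   is_levi_civita g nabla -> is_levi_civita gt nablat ->
   forall (v : M -> 'rV[R]_n) (p : M),
   smooth_field_on setT v ->
   forall (U : set M) (E : 'I_n -> M -> 'rV[R]_n)
     (N : 'I_k -> M -> 'rV[R]_(n + k)),
   open_nbhs p U -> orthonormal_frame_on g U E ->
   normal_frame_on gt iota U N ->
   forall F : 'I_n -> 'rV[R]_n, orthonormal_vectors g p F ->
   let W := weingarten g gt iota nablat p in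
   let H := mean_curvature_vector g gt iota nablat E p in
   ricci_op g nabla p F (v p) =
     n%:R *: W H (v p) - \sum_(l < k) W (N l p) (W (N l p) (v p)))
  /\
  (* hypersurfaces *)
  (forall (n : nat), (0 < n)%N ->
   forall (M : manifold R n) (Mt : manifold R (n + 1))
     (g : riemannian_metric M) (gt : riemannian_metric Mt) (iota : M -> Mt)
     (nabla : connection M) (nablat : connection Mt),
   is_riemannian_submanifold g gt iota ->
   is_levi_civita g nabla -> is_levi_civita gt nablat ->
   forall (v : M -> 'rV[R]_n) (p : M) (vt : Mt -> 'rV[R]_(n + 1)),
   smooth_field_on setT v -> extends_near iota p v vt ->
   forall (U : set M) (E : 'I_n -> M -> 'rV[R]_n) (N : M -> 'rV[R]_(n + 1)),
   open_nbhs p U -> orthonormal_frame_on g U E ->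
   normal_frame_on gt iota U (fun _ : 'I_1 => N) ->
   forall (F : 'I_n -> 'rV[R]_n) (Ft : 'I_(n + 1) -> 'rV[R]_(n + 1)),
   orthonormal_vectors g p F -> orthonormal_vectors gt (iota p) Ft ->
   let s := weingarten g gt iota nablat p (N p) in
   let H := mean_curvature g gt iota nablat p (N p) in
   let d := tangent_map iota p in
   let Rict := ricci_op gt nablat (iota p) Ft (vt (iota p)) in
   Rict = d (ricci_op g nabla p F (v p) - (n%:R * H) *: s (v p) +
             s (s (v p)) +
             \sum_(i < n) Rm gt nablat (iota p) (N p) (d (E i p))
                             (vt (iota p)) (N p) *: E i p)
          + normal_part g gt iota p Rict)
  /\
  (* hypersurfaces of Euclidean space *)
  (forall (n : nat), (0 < n)%N ->
   forall (M : manifold R n) (g : riemannian_metric M)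
     (iota : M -> euclidean_space R (n + 1))
     (nabla : connection M) (nablat : connection (euclidean_space R (n + 1))),
   let gt := euclidean_metric R (n + 1) in
   is_riemannian_submanifold g gt iota ->
   is_levi_civita g nabla -> is_levi_civita gt nablat ->
   forall (v : M -> 'rV[R]_n) (p : M),
   smooth_field_on setT v ->
   forall (U : set M) (N : M -> 'rV[R]_(n + 1)),
   open_nbhs p U -> normal_frame_on gt iota U (fun _ : 'I_1 => N) ->
   forall F : 'I_n -> 'rV[R]_n, orthonormal_vectors g p F ->
   let s := weingarten g gt iota nablat p (N p) in
   let H := mean_curvature g gt iota nablat p (N p) in
   ricci_op g nabla p F (v p) = (n%:R * H) *: s (v p) - s (s (v p))).

Proof.
split; [|split; [|split]].
- move=> n k n0 _ M Mt g gt iota nabla nablat iotaP nablaP nablatP v p vt _.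
  move=> [V [_ Vp] [_ vtE]] U E N [_ Up] [_ Eon] [_ Nn Non] F Ft Fon Fton /=.
  rewrite vtE// (scale_weingarten_mean_curvature iotaP nablaP nablatP)//.
  rewrite -(tangent_part_ricci_op iotaP nablaP nablatP (Eon _ Up) (Non _ Up)
    (Nn _ Up) _ Fon Fton).
  by rewrite /normal_part addrC subrK.
- move=> n k n0 _ M g iota nabla nablat gt iotaP nablaP nablatP v p _ U E N.
  move=> [_ Up] [_ Eon] [_ Nn Non] F Fon /=.
  rewrite (scale_weingarten_mean_curvature iotaP nablaP nablatP)//.
  exact: (ricci_op_euclidean_submanifold iotaP nablaP nablatP _ (Eon _ Up) Fon
    (Non _ Up) (Nn _ Up)).
- move=> n n0 M Mt g gt iota nabla nablat iotaP nablaP nablatP v p vt _.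
  move=> [V [_ Vp] [_ vtE]] U E N [_ Up] [_ Eon] [_ Nn Non] F Ft Fon Fton /=.
  rewrite vtE// -(weingarten_sum_second_form iotaP nablaP nablatP _ n0 (Eon _ Up)
    (Non _ Up) (Nn _ Up ord0)).
  have := tangent_part_ricci_op iotaP nablaP nablatP (Eon _ Up) (Non _ Up)
    (Nn _ Up) (v p) Fon Fton.
  rewrite big_ord1 addrA => <-.
  by rewrite /normal_part addrC subrK.
- move=> n n0 M g iota nabla nablat gt iotaP nablaP nablatP v p _ U N.
  move=> [_ Up] [_ Nn Non] F Fon /=.
  rewrite -(weingarten_sum_second_form iotaP nablaP nablatP _ n0 Fon
    (Non _ Up) (Nn _ Up ord0)).
  rewrite (ricci_op_euclidean_submanifold iotaP nablaP nablatP (v p) Fon Fon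
    (Non _ Up) (Nn _ Up)).
  by rewrite big_ord1.
Qed.
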